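(* Let $\mathbb D:\mathcal S\to\mathcal S$, $\mathcal S=\mathcal B\otimes\mathbb S$, be the linear operator $\mathbb D(b\otimes x)=-i\sum_j\partial_j(b)\otimes\gamma(\theta_j)x$. (i) $\mathbb D$ is $F_{\mathcal S}$-covariant: $F_{\mathcal S}\mathbb D=(\mathbb D\otimes\mathrm{id})F_{\mathcal S}$. In particular $\mathbb D(\mathcal S_M)\subseteq\mathcal S_M$, where $\mathcal S_M=\{\psi\in\mathcal S:F_{\mathcal S}(\psi)=\psi\otimes1\}$. (ii) $\langle\psi,\mathbb D(\varphi)\rangle=\langle\mathbb D(\psi),\varphi\rangle$ for all $\psi,\varphi\in\mathcal S$.
   Context: **Group and bundle.** $G$ is a compact matrix quantum group with Hopf $*$-algebra $\mathcal A$ of polynomial functions (coproduct $\phi(a)=a^{(1)}\otimes a^{(2)}$, counit $\epsilon$, antipode $\kappa$, Haar state $h$). $P=(\mathcal B,i,F)$ is a quantum principal $G$-bundle over a quantum space $M$ represented by a unital $*$-algebra $\mathcal V$: $\mathcal B$ is a unital $*$-algebra, $i:\mathcal V\to\mathcal B$ an injective unital $*$-homomorphism (treated as inclusion), $F:\mathcal B\to\mathcal B\otimes\mathcal A$ a unital $*$-homomorphism with $(\mathrm{id}\otimes\phi)F=(F\otimes\mathrm{id})F$, $(\mathrm{id}\otimes\epsilon)F=\mathrm{id}$, $\mathcal V=\{b: F(b)=b\otimes1\}$, and $q\otimes b\mapsto qF(b)$ maps $\mathcal B\otimes_{\mathcal V}\mathcal B$ onto $\mathcal B\otimes\mathcal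 A$. Write $F(b)=\sum_kb_k\otimes c_k$. **Coordinate space.** $\mathbb V$ is a finite-dimensional complex vector space (the left-invariant part of a $*$-covariant bicovariant $\mathcal A$-bimodule) with an antilinear involution $*$, a right $\mathcal A$-module structure $\circ$ and a right coaction $\varkappa:\mathbb V\to\mathbb V\otimes\mathcal A$ such that $\varkappa*=( *\otimes* )\varkappa$, $(\theta\circ a)^*=\theta^*\circ\kappa(a)^*$, $\varkappa(\theta\circ a)=\sum_k(\theta_k\circ a^{(2)})\otimes\kappa(a^{(1)})c_ka^{(3)}$ if $\varkappa(\theta)=\sum_k\theta_k\otimes c_k$. $\tau(\eta\otimes\vartheta)=\sum_k\vartheta_k\otimes(\eta\circ c_k)$ is the associated braid operator. $\mathbb V$ has a $\varkappa$-invariant scalar product $(\cdot,\cdot)$; the positive operator $C_\varkappa$ with $(x^*,y^* )=(y,C_\varkappa x)$ satisfies $\varkappa C_\varkappa=(C_\varkappa\otimes\kappa^2)\varkappa$, $\mathrm{tr}\,C_\varkappa=\mathrm{tr}\,C_\varkappa^{-1}$, and $*=J_\varkappa C_\varkappa^{1/2}=C_\varkappa^{-1/2}J_\varkappa$ with $J_\varkappa$ an antiunitary involution. $\theta_1,\dots,\theta_d$ is an orthonormal basis with $J_\varkappa\theta_i=\theta_i$. **Quantum metric and Clifford algebra.** $\sigma:\mathbb V\otimes\mathbb V\to\mathbb V\otimes\mathbb V$ is an invertible braid operator with $*\sigma=\sigma*$ (where $(x\otimes y)^*=y^*\otimes x^*$), compatible with $\circ$ and $\varkappa$. $\Sigma$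 is a unital $*$-algebra and $g:\mathbb V\otimes\mathbb V\to\Sigma$ is linear with $g\sigma=g$, $g(x,y)^*=g(y^*,x^* )$, $(g(\theta_i,\theta_j))$ invertible over $\Sigma$, and $\Sigma$ generated by the entries of this matrix and its inverse; there is a twisting $\nu_\Sigma:\mathbb V\otimes\Sigma\to\Sigma\otimes\mathbb V$ coming from a unital homomorphism $\Sigma\to M_d(\Sigma)$ with $\nu_\Sigma(\mathrm{id}\otimes g)=(g\otimes\mathrm{id})(\mathrm{id}\otimes\sigma)(\sigma^{-1}\otimes\mathrm{id})$, making $\mathbb V_\Sigma=\Sigma\otimes\mathbb V$ a $\Sigma$-bimodule; and, with $g\cdot g:x\otimes y\otimes z\otimes t\mapsto g(x,y)g(z,t)$, $g\cdot g=(g\cdot g)(\mathrm{id}\otimes\sigma\otimes\mathrm{id})(\sigma^{\mp1}\otimes\sigma^{\pm1})(\mathrm{id}\otimes\sigma^{-1}\otimes\mathrm{id})$, so that $\sigma,g$ extend $\Sigma$-bilinearly to $\mathbb V_\Sigma\otimes_\Sigma\mathbb V_\Sigma$. $\Sigma$ carries a right $\mathcal A$-module structure and a coaction determined by $g(x,y)\circ a=g(x\circ a^{(1)},y\circ a^{(2)})$, $\varkappa_\Sigma g(x,y)=(g\otimes\mathrm{id})\varkappa(x\otimes y)$. $A^n_\sigma=\sum_{\pi\in S_n}(-1)^{\ell(\pi)}\sigma_\pi$, with $\mathrm{im}(A^n_\sigma)$ assumed to be the space of $\tau$-antisymmetric $n$-tensors; $\mathbb V^\wedge=\mathbb V^\otimes/\ker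 A_\sigma$ and $\mathbb V_\Sigma^\wedge=\mathbb V_\Sigma^\otimes/\ker A_\sigma\leftrightarrow\Sigma\otimes\mathbb V^\wedge$, with $\circ,\varkappa$ extended multiplicatively. The braided Clifford algebra $\mathrm{cl}[\mathbb V,g,\sigma,\Sigma]$ is the space $\mathbb V_\Sigma^\wedge$ with the product $\tilde m=m(\mathrm{id}\otimes g_\wedge\otimes\mathrm{id})(\phi_\wedge\otimes\phi_\wedge)$ ($m$ exterior product, $\phi_\wedge$ deconcatenation coproduct on $\mathbb V_\Sigma^\wedge\leftrightarrow\mathrm{im}A_\sigma$, $g_\wedge(\psi,\xi)=g(\psi,A_\sigma\xi)$, $g((\psi\otimes x)\otimes(y\otimes\xi))=g(\psi,g(x,y)\xi)$) and the antimultiplicative $*$ extending those of $\mathbb V$ and $\Sigma$. **Frame structure.** $\mathrm{hor}_P=\mathcal B\otimes\mathbb V^\wedge$ with $(q\otimes\vartheta)(b\otimes\eta)=\sum_kqb_k\otimes(\vartheta\circ c_k)\eta$ and $(b\otimes\vartheta)^*=\sum_kb_k^*\otimes(\vartheta^*\circ c_k^* )$ (graded $*$ on $\mathbb V^\wedge$); $F^\wedge$ is the product coaction of $F$ and $\varkappa$. $\nabla:\mathrm{hor}_P\to\mathrm{hor}_P$ is a degree-one hermitian graded antiderivation intertwining $F^\wedge$, vanishing on the subalgebra generated by $\nabla(\mathcal V)$ and $1\otimes\mathbb V^\wedge$, and there are linear maps $b_\alpha:\mathbb V\to\mathcal B$ and $f_\alpha\in\mathcal V$ (finitely many) with $1\otimes\theta=\sum_\alpha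 b_\alpha(\theta)\nabla(f_\alpha)$, $F[b_\alpha(\theta)]=(b_\alpha\otimes\mathrm{id})\varkappa(\theta)$. The maps $\partial_i:\mathcal B\to\mathcal B$ are defined by $\nabla(b)=\sum_i\partial_i(b)\otimes\theta_i$. **Measure.** $\mathcal V$ is a dense $*$-subalgebra of a unital C*-algebra with a faithful state $\omega_M$; $\int_\uparrow=(\mathrm{id}\otimes h)F:\mathcal B\to\mathcal V$ is strictly positive ($\int_\uparrow(b^*b)\ge0$, with equality only for $b=0$); $\omega_P=\omega_M\circ\int_\uparrow$. Horizontal homogeneity is assumed: $\omega_M\{\sum_{ij}[C_\varkappa^{-1}]_{ji}\partial_i(b_\alpha(\theta_j)f)\}=0$ for all $f\in\mathcal V$ and all $\alpha$, where $[C_\varkappa^{-1}]_{ij}=(\theta_i,C_\varkappa^{-1}\theta_j)$. $\mathcal B$ carries the scalar product $\langle b,q\rangle=\omega_P(b^*q)$. **Spinors.** $\mathbb S$ is a finite-dimensional Hilbert space with an irreducible $*$-representation $\gamma:\mathrm{cl}[\mathbb V,g,\sigma,\Sigma]\to B(\mathbb S)$ and a unitary representation $\varkappa_{\mathbb S}:\mathbb S\to\mathbb S\otimes\mathcal A$ of $G$ with $\varkappa_{\mathbb S}(Z\xi)=\varkappa(Z)\varkappa_{\mathbb S}(\xi)$ for all Clifford elements $Z$ and $\xi\in\mathbb S$. $F_{\mathcal S}:\mathcal S\to\mathcal S\otimes\mathcal A$ is the product of the coactions $F$ and $\varkappa_{\mathbb S}$, and $\mathcal S$ carries the product scalar product $\langle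 b\otimes\zeta,q\otimes\xi\rangle=\omega_P(b^*q)(\zeta,\xi)$. *)

(* Defs.v *)
From HB Require Import structures.
From mathcomp Require Import fingroup perm.
From mathcomp Require Import all_boot all_order all_algebra.
From mathcomp Require Import complex.
From mathcomp Require Import boolp classical_sets reals.

Set Implicit Arguments.
Unset Strict Implicit.
Unset Printing Implicit Defensive.

Import Order.TTheory GRing.Theory Num.Theory.
Local Open Scope ring_scope.

#[local] Obligation Tactic := idtac.

(* Modules given by generators and relations: finite formal sums of           *)
(* generators, two sums being equal when every map compatible with the        *)
(* relations (with values in any abelian group) takes the same value on them. *)
(* Compatibility is only additive, so that antilinear maps can be lifted too. *)
Record presentation (K : fieldType) := Presentation {
  gens : choiceType;
  pscale : K -> gens -> gens;
  compat : forall W : zmodType, (gens -> W) -> Prop;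
  compatZ : forall (W : zmodType) (f : gens -> W) a,
    compat f -> compat (f \o pscale a);
  compatZA : forall (W : zmodType) (f : gens -> W) a b x,
    compat f -> f (pscale a (pscale b x)) = f (pscale (a * b) x);
  compatZD : forall (W : zmodType) (f : gens -> W) a b x,
    compat f -> f (pscale (a + b) x) = f (pscale a x) + f (pscale b x);
  compatZ1 : forall (W : zmodType) (f : gens -> W) x,
    compat f -> f (pscale 1 x) = f x }.

Section Presented.
Variables (K : fieldType) (P : presentation K).

Definition peq (s t : seq (gens P)) : bool :=
  `[< forall (W : zmodType) (f : gens P -> W), compat f ->
      \sum_(x <- s) f x = \sum_(x <- t) f x >].

Lemma peq_refl : reflexive peq.
Proof. by move=> s; apply/asboolP. Qed.

Lemma peq_sym : symmetric peq.
Proof. by move=> s t; apply/asboolP/asboolP=> st W f fP; rewrite st. Qed.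

Lemma peq_trans : transitive peq.
Proof.
move=> t s u /asboolP st /asboolP tu; apply/asboolP=> W f fP.
by rewrite st// tu.
Qed.

Canonical peq_equiv := EquivRel peq peq_refl peq_sym peq_trans.

Definition presented : Type := {eq_quot peq_equiv}%qT.
HB.instance Definition _ := Choice.on presented.
HB.instance Definition _ := Quotient.on presented.
HB.instance Definition _ := EqQuotient.on presented.

(* Meaningful when f is compatible (see pliftE). *)
Definition plift (W : zmodType) (f : gens P -> W) (q : presented) : W :=
  \sum_(x <- repr q) f x.

Definition pclass (s : seq (gens P)) : presented := (\pi_presented s)%qT.

Definition pgen (x : gens P) : presented := pclass [:: x].

Lemma plift_class (W : zmodType) (f : gens P -> W) s :
  compat f -> plift f (pclass s) = \sum_(x <- s) f x.
Proof.
move=> fP; rewrite /plift.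
have /eqmodP/asboolP -> // : (repr (pclass s) = s %[mod presented])%qT.
by rewrite reprK.
Qed.

Lemma pliftE (W : zmodType) (f : gens P -> W) x :
  compat f -> plift f (pgen x) = f x.
Proof. by move=> fP; rewrite plift_class// big_seq1. Qed.

Lemma presented_ext (p q : presented) :
  (forall (W : zmodType) (f : gens P -> W), compat f -> plift f p = plift f q) ->
  p = q.
Proof.
move=> pq; rewrite -[p]reprK -[q]reprK.
by apply/eqmodP/asboolP=> W f fP; exact: pq.
Qed.

Definition padd (p q : presented) := pclass (repr p ++ repr q).
Definition pscal (a : K) (p : presented) := pclass (map (pscale a) (repr p)).

Lemma plift_add (W : zmodType) (f : gens P -> W) p q :
  compat f -> plift f (padd p q) = plift f p + plift f q.
Proof. by move=> fP; rewrite plift_class// big_cat. Qed.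

Lemma plift_scal (W : zmodType) (f : gens P -> W) a p :
  compat f -> plift f (pscal a p) = plift (f \o pscale a) p.
Proof. by move=> fP; rewrite plift_class// big_map. Qed.

Lemma plift_nil (W : zmodType) (f : gens P -> W) :
  compat f -> plift f (pclass [::]) = 0.
Proof. by move=> fP; rewrite plift_class// big_nil. Qed.

Lemma paddA : associative padd.
Proof. by move=> p q r; apply: presented_ext=> W f fP; rewrite !plift_add// addrA. Qed.

Lemma paddC : commutative padd.
Proof. by move=> p q; apply: presented_ext=> W f fP; rewrite !plift_add// addrC. Qed.

Lemma padd0 : left_id (pclass [::]) padd.
Proof. by move=> p; apply: presented_ext=> W f fP; rewrite plift_add// plift_nil// add0r. Qed.

Lemma compat_scale0 (W : zmodType) (f : gens P -> W) x :
  compat f -> f (pscale 0 x) = 0.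
Proof.
by move=> fP; apply: (addrI (f (pscale 0 x))); rewrite addr0 -compatZD// addr0.
Qed.

Lemma paddN : left_inverse (pclass [::]) (pscal (-1)) padd.
Proof.
move=> p; apply: presented_ext=> W f fP.
rewrite plift_add// plift_scal// plift_nil// /plift -big_split/=.
by apply: big1=> x _; rewrite -[f x](compatZ1 x fP) -compatZD// addNr compat_scale0.
Qed.

HB.instance Definition _ := GRing.isZmodule.Build presented paddA paddC padd0 paddN.

Lemma pscalA a b p : pscal a (pscal b p) = pscal (a * b) p.
Proof.
apply: presented_ext=> W f fP.
rewrite !plift_scal//; last exact: compatZ.
by apply: eq_bigr=> x _; rewrite /= compatZA.
Qed.

Lemma pscal1 : left_id 1 pscal.
Proof.
move=> p; apply: presented_ext=> W f fP; rewrite plift_scal//.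
by apply: eq_bigr=> x _; rewrite /= compatZ1.
Qed.

Lemma pscalDr : right_distributive pscal +%R.
Proof.
move=> a p q; apply: presented_ext=> W f fP.
rewrite plift_scal// !plift_add// ?plift_scal//; exact: compatZ.
Qed.

Lemma pscalDl p : {morph pscal^~ p : a b / a + b}.
Proof.
move=> a b; apply: presented_ext=> W f fP.
rewrite plift_add// !plift_scal// -big_split/=.
by apply: eq_bigr=> x _; rewrite /= compatZD.
Qed.

HB.instance Definition _ :=
  GRing.Zmodule_isLmodule.Build K presented pscalA pscal1 pscalDr pscalDl.

Lemma plift_is_additive (W : zmodType) (f : gens P -> W) :
  compat f -> {morph plift f : p q / p + q}.
Proof. by move=> fP p q; exact: plift_add. Qed.

Lemma presentedE (p : presented) : p = \sum_(x <- repr p) pgen x.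
Proof.
apply: presented_ext=> W f fP.
have f0 : plift f 0 = 0 by exact: plift_nil.
rewrite (big_morph _ (plift_is_additive fP) f0) {1}/plift.
by apply: eq_bigr=> x _; rewrite pliftE.
Qed.

End Presented.

Definition balanced (K : fieldType) (U V : lmodType K) (W : zmodType)
    (f : U -> V -> W) : Prop :=
  [/\ forall x x' y, f (x + x') y = f x y + f x' y,
      forall x y y', f x (y + y') = f x y + f x y' &
      forall a x y, f (a *: x) y = f x (a *: y)].

Program Definition tens_presentation (K : fieldType) (U V : lmodType K) :
    presentation K :=
  @Presentation K (U * V)%type (fun a p => (a *: p.1, p.2))
    (fun W f => balanced (fun x y => f (x, y))) _ _ _ _.
Next Obligation.
move=> K U V W f a [fl fr fZ]; split=> [x x' y|x y y'|b x y] /=.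
- by rewrite scalerDr fl.
- by rewrite fr.
- by rewrite scalerA mulrC -scalerA fZ.
Qed.
Next Obligation. by move=> K U V W f a b x _ /=; rewrite scalerA. Qed.
Next Obligation. by move=> K U V W f a b x [fl _ _] /=; rewrite scalerDl fl. Qed.
Next Obligation. by move=> K U V W f [x y] _ /=; rewrite scale1r. Qed.

Definition tens (K : fieldType) (U V : lmodType K) : lmodType K :=
  presented (tens_presentation U V).

Definition tpure (K : fieldType) (U V : lmodType K) (x : U) (y : V) : tens U V :=
  @pgen K (tens_presentation U V) (x, y).

Definition tlift (K : fieldType) (U V : lmodType K) (W : zmodType)
    (t : tens U V) (f : U -> V -> W) : W :=
  @plift K (tens_presentation U V) W (fun p => f p.1 p.2) t.
Arguments tlift {K U V W} t f.
Arguments tens {K} U V.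

Notation "x ⊗ y" := (tpure x y) (at level 40, left associativity) : ring_scope.

(* Sweedler-type sums: if t is the sum of the x_k ⊗ y_k, then                 *)
(* \tsum_(x ⊗ y <- t) E x y is the sum of the E x_k y_k.                      *)
Notation "\tsum_ ( x ⊗ y <- t ) E" := (tlift t (fun x y => E))
  (at level 41, x name, y name, t at level 50, E at level 41,
   format "\tsum_ ( x  ⊗  y  <-  t )  E") : ring_scope.

Lemma tliftE (K : fieldType) (U V : lmodType K) (W : zmodType)
  (f : U -> V -> W) x y : balanced f -> tlift (x ⊗ y) f = f x y.
Proof. by move=> fP; rewrite /tlift pliftE. Qed.

Lemma tliftD (K : fieldType) (U V : lmodType K) (W : zmodType)
  (f : U -> V -> W) : balanced f -> {morph tlift^~ f : s t / s + t}.
Proof. by move=> fP; exact: (@plift_is_additive K (tens_presentation U V)). Qed.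

Lemma tens_sum (K : fieldType) (U V : lmodType K) (t : tens U V) :
  exists s : seq (U * V), t = \sum_(p <- s) p.1 ⊗ p.2.
Proof.
exists (repr (t : presented (tens_presentation U V))).
by rewrite {1}[t]presentedE; apply: eq_bigr=> -[].
Qed.

Lemma tpure_balanced (K : fieldType) (U V : lmodType K) :
  balanced (fun (x : U) (y : V) => x ⊗ y).
Proof.
split=> [x x' y|x y y'|a x y]; apply: presented_ext=> W f fP;
  rewrite ?plift_is_additive// /tpure !pliftE//; by case: fP.
Qed.

Lemma tpureZ (K : fieldType) (U V : lmodType K) a (x : U) (y : V) :
  a *: (x ⊗ y) = (a *: x) ⊗ y.
Proof.
apply: presented_ext=> W f fP; rewrite /tpure pliftE//.
by rewrite [LHS]plift_scal// pliftE//; exact: compatZ.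
Qed.

Section TensorOps.
Variable K : fieldType.

Definition tmap (U V U' V' : lmodType K) (f : U -> U') (g : V -> V')
    (t : tens U V) : tens U' V' :=
  \tsum_(x ⊗ y <- t) f x ⊗ g y.

Definition tassoc (U V W : lmodType K) (t : tens (tens U V) W) :
    tens U (tens V W) :=
  \tsum_(r ⊗ z <- t) \tsum_(x ⊗ y <- r) x ⊗ (y ⊗ z).

Definition tmul (A B : algType K) (s t : tens A B) : tens A B :=
  \tsum_(a ⊗ b <- s) \tsum_(a' ⊗ b' <- t) (a * a') ⊗ (b * b').

(* The product of two coactions (see coaction below). *)
Definition coact2 (A : algType K) (U V : lmodType K)
    (f : U -> tens U A) (g : V -> tens V A) (t : tens U V) : tens (tens U V) A :=
  \tsum_(x ⊗ y <- t) \tsum_(x0 ⊗ c <- f x) \tsum_(y0 ⊗ d <- g y)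
    (x0 ⊗ y0) ⊗ (c * d).

End TensorOps.

Arguments tmap {K U V U' V'} f g t.
Arguments tassoc {K U V W} t.
Arguments tmul {K A B} s t.
Arguments coact2 {K A U V} f g t.

(* The space of all tensors over V: the direct sum of the tensor powers of V. *)
(* It is spanned by words, i.e. products of vectors; a generator is a pair    *)
(* (coefficient, word).                                                       *)
Definition multilinear (K : fieldType) (V : lmodType K) (W : zmodType)
    (f : K * seq V -> W) : Prop :=
  [/\ forall a b w, f (a + b, w) = f (a, w) + f (b, w),
      forall a s x y t,
        f (a, s ++ (x + y) :: t) = f (a, s ++ x :: t) + f (a, s ++ y :: t) &
      forall a b s x t, f (a, s ++ (b *: x) :: t) = f (a * b, s ++ x :: t)].

Program Definition talg_presentation (K : fieldType) (V : lmodType K) :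
    presentation K :=
  @Presentation K (K * seq V)%type (fun a p => (a * p.1, p.2))
    (fun W f => multilinear f) _ _ _ _.
Next Obligation.
move=> K V W f c [fD fV fZ]; split=> [a b w|a s x y t|a b s x t] /=.
- by rewrite mulrDr fD.
- by rewrite fV.
- by rewrite fZ mulrA.
Qed.
Next Obligation. by move=> K V W f a b x _ /=; rewrite mulrA. Qed.
Next Obligation. by move=> K V W f a b x [fD _ _] /=; rewrite mulrDl fD. Qed.
Next Obligation. by move=> K V W f [x y] _ /=; rewrite mul1r. Qed.

Definition talg (K : fieldType) (V : lmodType K) : lmodType K :=
  presented (talg_presentation V).

Arguments talg {K} V.

Section TensorSpace.
Variables (K : fieldType) (V : lmodType K).

Definition word (w : seq V) : talg V :=
  @pgen K (talg_presentation V) (1, w).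

Definition wlift (W : lmodType K) (f : seq V -> W) (t : talg V) : W :=
  @plift K (talg_presentation V) W (fun p => p.1 *: f p.2) t.

Definition is_tensor (n : nat) (t : talg V) : Prop :=
  exists2 s : seq (K * seq V), all (fun p => size p.2 == n) s &
    t = \sum_(p <- s) p.1 *: word p.2.

Definition at_word (rho : tens V V -> tens V V) (i : nat) (w : seq V) : talg V :=
  match drop i w with
  | x :: y :: w' =>
      \tsum_(x' ⊗ y' <- rho (x ⊗ y)) word (take i w ++ x' :: y' :: w')
  | _ => word w
  end.

(* rho acting on the tensor factors number i and i + 1, counted from 0 *)
Definition at_pos rho (i : nat) : talg V -> talg V := wlift (at_word rho i).

Definition deconcatenation : talg V -> tens (talg V) (talg V) :=
  wlift (fun w => \sum_(k < (size w).+1) word (take k w) ⊗ word (drop k w)).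

Definition tcons (x : V) : talg V -> talg V := wlift (fun w => word (x :: w)).

Definition is_braid (rho : tens V V -> tens V V) : Prop :=
  forall x y z : V,
    at_pos rho 0 (at_pos rho 1 (at_pos rho 0 (word [:: x; y; z]))) =
    at_pos rho 1 (at_pos rho 0 (at_pos rho 1 (word [:: x; y; z]))).

End TensorSpace.

Arguments word {K V} w.
Arguments wlift {K V W} f t.
Arguments is_tensor {K V} n t.
Arguments at_pos {K V} rho i t.
Arguments deconcatenation {K V} t.

Definition inversions (n : nat) (p : 'S_n) : nat :=
  #|[set ij : 'I_n * 'I_n | (ij.1 < ij.2)%N && (p ij.2 < p ij.1)%N]|.

Definition adj_tperm (n i : nat) : 'S_n :=
  match insub i, insub i.+1 with
  | Some j, Some k => tperm j k
  | _, _ => 1%g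
  end.

Definition reduced_word (n : nat) (p : 'S_n) (w : seq nat) : Prop :=
  [/\ all (fun i => i.+1 < n)%N w, size w = inversions p &
      p = (\prod_(i <- w) adj_tperm n i)%g].

Section Antisymmetrizer.
Variables (K : fieldType) (V : lmodType K) (sigma : tens V V -> tens V V).

(* xget picks a reduced word of p; the result does not depend on the choice   *)
(* when sigma satisfies the braid equation.                                   *)
Definition braid_perm (n : nat) (p : 'S_n) (t : talg V) : talg V :=
  foldr (at_pos sigma) t (xget [::] [set w | reduced_word p w]%classic).

Definition antisym : talg V -> talg V :=
  wlift (fun w => \sum_(p : 'S_(size w))
                    (-1) ^+ inversions p *: braid_perm p (word w)).

End Antisymmetrizer.

Definition antilinear (R : realType) (U V : lmodType R[i]) (f : U -> V) : Prop :=
  (forall x y, f (x + y) = f x + f y) /\ (forall a x, f (a *: x) = a^* *: f x).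

Record star_alg (R : realType) := StarAlg {
  sa_alg :> algType R[i];
  star : sa_alg -> sa_alg;
  star_antilinear : antilinear star;
  starM : forall x y, star (x * y) = star y * star x;
  starK : involutive star }.

Record cstar_alg (R : realType) := CStarAlg {
  cs_alg :> star_alg R;
  cnorm : cs_alg -> R[i];
  cnorm_ge0 : forall x, 0 <= cnorm x;
  cnorm_eq0 : forall x, cnorm x = 0 -> x = 0;
  cnormD : forall x y, cnorm (x + y) <= cnorm x + cnorm y;
  cnormZ : forall a x, cnorm (a *: x) = `|a| * cnorm x;
  cnormM : forall x y, cnorm (x * y) <= cnorm x * cnorm y;
  cnorm_star : forall x, cnorm (star x * x) = cnorm x ^+ 2;
  cnorm_complete : forall u : nat -> cs_alg,
    (forall e : R[i], 0 < e -> exists N, forall m n,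
        (N <= m)%N -> (N <= n)%N -> cnorm (u m - u n) < e) ->
    exists l, forall e : R[i], 0 < e -> exists N, forall n,
        (N <= n)%N -> cnorm (u n - l) < e }.

Definition tstar (R : realType) (A B : star_alg R) (t : tens A B) : tens A B :=
  \tsum_(a ⊗ b <- t) star a ⊗ star b.

(* Unital *-homomorphisms into an algebraic tensor product of *-algebras. *)
Definition tens_star_hom (R : realType) (X A B : star_alg R)
    (f : X -> tens A B) : Prop :=
  [/\ f 1 = 1 ⊗ 1, forall x y, f (x * y) = tmul (f x) (f y) &
      forall x, f (star x) = tstar (f x)].

Inductive gen_subalg (K : fieldType) (X : lmodType K) (mul : X -> X -> X)
    (one : X) (S : X -> Prop) : X -> Prop :=
  | gen_in x : S x -> gen_subalg mul one S x
  | gen_one : gen_subalg mul one S one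
  | gen_add x y : gen_subalg mul one S x -> gen_subalg mul one S y ->
      gen_subalg mul one S (x + y)
  | gen_scale a x : gen_subalg mul one S x -> gen_subalg mul one S (a *: x)
  | gen_mul x y : gen_subalg mul one S x -> gen_subalg mul one S y ->
      gen_subalg mul one S (mul x y).

(* Scalar products are antilinear in the first variable. *)
Record scalar_product (R : realType) (V : lmodType R[i]) := ScalarProduct {
  dot :> V -> V -> R[i];
  dotDr : forall x y z, dot x (y + z) = dot x y + dot x z;
  dotZr : forall a x y, dot x (a *: y) = a * dot x y;
  dot_conj : forall x y, dot x y = (dot y x)^*;
  dot_ge0 : forall x, 0 <= dot x x;
  dot_eq0 : forall x, dot x x = 0 -> x = 0 }.

(* Compact matrix quantum groups, through the Hopf *-algebra of polynomial    *)
(* functions: it is generated by the matrix elements (and their adjoints) of  *)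
(* a fundamental representation and has a Haar state.                         *)
Record cmqg (R : realType) := CMQG {
  pol :> star_alg R;
  cop : {linear pol -> tens pol pol};
  eps : {scalar pol};
  antip : {linear pol -> pol};
  haar : {scalar pol};
  fdim : nat;
  fund : 'M[pol]_fdim;
  cop_hom : tens_star_hom cop;
  cop_coassoc : forall a, tassoc (tmap cop id (cop a)) = tmap id cop (cop a);
  cop_epsl : forall a, \tsum_(a1 ⊗ a2 <- cop a) (eps a1 *: a2) = a;
  cop_epsr : forall a, \tsum_(a1 ⊗ a2 <- cop a) (eps a2 *: a1) = a;
  eps1 : eps 1 = 1;
  epsM : forall a b : pol, eps (a * b) = eps a * eps b;
  eps_star : forall a, eps (star a) = (eps a)^*;
  antipl : forall a, \tsum_(a1 ⊗ a2 <- cop a) (antip a1 * a2) = eps a *: 1;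
  antipr : forall a, \tsum_(a1 ⊗ a2 <- cop a) (a1 * antip a2) = eps a *: 1;
  antipM : forall a b : pol, antip (a * b) = antip b * antip a;
  antip_star : forall a, antip (star (antip (star a))) = a;
  haar1 : haar 1 = 1;
  haar_ge0 : forall a, 0 <= haar (star a * a);
  haar_invl : forall a, \tsum_(a1 ⊗ a2 <- cop a) (haar a1 *: a2) = haar a *: 1;
  haar_invr : forall a, \tsum_(a1 ⊗ a2 <- cop a) (haar a2 *: a1) = haar a *: 1;
  fund_cop : forall i j, cop (fund i j) = \sum_k fund i k ⊗ fund k j;
  fund_eps : forall i j, eps (fund i j) = (i == j)%:R;
  fund_gen : forall a, gen_subalg *%R 1
    (fun b => exists i j, b = fund i j \/ b = star (fund i j)) a }.

Section OverGroup.
Variables (R : realType) (G : cmqg R).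

Definition coaction (X : lmodType R[i]) (f : X -> tens X G) : Prop :=
  (forall x, tassoc (tmap f id (f x)) = tmap id (cop G) (f x)) /\
  (forall x, \tsum_(x0 ⊗ a <- f x) (eps G a *: x0) = x).

Definition right_module (X : lmodType R[i]) (act : X -> G -> X) : Prop :=
  [/\ forall x y a, act (x + y) a = act x a + act y a,
      forall x a b, act x (a + b) = act x a + act x b,
      forall z x a, act (z *: x) a = z *: act x a /\ act x (z *: a) = z *: act x a,
      forall x, act x 1 = x &
      forall x a b, act x (a * b) = act (act x a) b].

(* x ⊗ y -> (x o a') ⊗ (y o a''), with cop a = a' ⊗ a'' *)
Definition act2 (X Y : lmodType R[i]) (actX : X -> G -> X) (actY : Y -> G -> Y)
    (t : tens X Y) (a : G) : tens X Y :=
  \tsum_(x ⊗ y <- t) \tsum_(a1 ⊗ a2 <- cop G a) actX x a1 ⊗ actY y a2.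

Definition invariant_product (X : lmodType R[i]) (f : X -> tens X G)
    (p : X -> X -> R[i]) : Prop :=
  forall x y, \tsum_(x0 ⊗ c <- f x) \tsum_(y0 ⊗ d <- f y)
    (p x0 y0 *: (star c * d)) = p x y *: 1.

(* Quantum principal bundles. The map q ⊗ b -> q F(b) factors through the     *)
(* tensor product over the functions on the base; only its image matters in   *)
(* pb_free, so the complex tensor product is used there.                      *)
Record qbundle := QBundle {
  pbase : star_alg R;
  ptotal : star_alg R;
  inc : {linear pbase -> ptotal};
  Fco : {linear ptotal -> tens ptotal G};
  inc1 : inc 1 = 1;
  incM : forall f g : pbase, inc (f * g) = inc f * inc g;
  inc_star : forall f, inc (star f) = star (inc f);
  inc_inj : injective inc;
  Fco_hom : tens_star_hom Fco;
  Fco_coaction : coaction Fco;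
  base_fixed : forall b, Fco b = b ⊗ 1 <-> exists f, b = inc f;
  pb_free : forall t : tens ptotal G, exists s : tens ptotal ptotal,
    \tsum_(q ⊗ b <- s) tmul (q ⊗ 1) (Fco b) = t }.

Record coord_space := CoordSpace {
  cV :> vectType R[i];
  vstar : cV -> cV;
  vact : cV -> G -> cV;
  vco : {linear cV -> tens cV G};
  vdot : scalar_product cV;
  Ck : 'End(cV);
  Ck_half : 'End(cV);
  Jk : cV -> cV;
  theta : (\dim {:cV}).-tuple cV;
  vstar_antilinear : antilinear vstar;
  vstarK : involutive vstar;
  vact_module : right_module vact;
  vco_coaction : coaction vco;
  vco_star : forall x, vco (vstar x) = \tsum_(y ⊗ c <- vco x) vstar y ⊗ star c;
  vact_star : forall x a, vstar (vact x a) = vact (vstar x) (star (antip G a));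
  vco_act : forall x a, vco (vact x a) =
    \tsum_(a1 ⊗ a23 <- cop G a) \tsum_(a2 ⊗ a3 <- cop G a23) \tsum_(y ⊗ c <- vco x)
      vact y a2 ⊗ (antip G a1 * c * a3);
  vdot_inv : invariant_product vco vdot;
  Ck_pos : forall x, 0 <= vdot x (Ck x);
  Ck_def : forall x y, vdot (vstar x) (vstar y) = vdot y (Ck x);
  Ck_vco : forall x, vco (Ck x) = tmap Ck (fun c => antip G (antip G c)) (vco x);
  Ck_half_pos : forall x, 0 <= vdot x (Ck_half x);
  Ck_halfK : (Ck_half \o Ck_half)%VF = Ck;
  Jk_antilinear : antilinear Jk;
  JkK : involutive Jk;
  Jk_antiunitary : forall x y, vdot (Jk x) (Jk y) = vdot y x;
  vstarE : forall x, vstar x = Jk (Ck_half x);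
  vstarE' : forall x, vstar x = (Ck_half^-1)%VF (Jk x);
  theta_basis : basis_of fullv theta;
  theta_ortho : forall i j, vdot (tnth theta i) (tnth theta j) = (i == j)%:R;
  theta_real : forall i, Jk (tnth theta i) = tnth theta i;
  Ck_trace : \tr (passmx.mxof theta theta Ck) = \tr (passmx.mxof theta theta (Ck^-1)%VF) }.

Definition vdim (X : coord_space) : nat := \dim {:X}.

Definition tau (X : coord_space) (t : tens X X) : tens X X :=
  \tsum_(x ⊗ y <- t) \tsum_(y0 ⊗ c <- vco X y) y0 ⊗ vact x c.

(* The extension of a twisting nu : V ⊗ S -> S ⊗ V to all tensors over V.     *)
Fixpoint nu_word (X : lmodType R[i]) (S : algType R[i])
    (nu : tens X S -> tens S X) (w : seq X) (s : S) : tens S (talg X) :=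
  match w with
  | [::] => s ⊗ word [::]
  | x :: w' => \tsum_(s1 ⊗ t <- nu_word nu w' s)
                 \tsum_(s2 ⊗ x' <- nu (x ⊗ s1)) s2 ⊗ tcons x' t
  end.

Definition gg_word (X : lmodType R[i]) (S : algType R[i]) (g : tens X X -> S)
    (w : seq X) : S :=
  if w is [:: x; y; z; t] then g (x ⊗ y) * g (z ⊗ t) else 0.

Definition g_id_word (X : lmodType R[i]) (S : algType R[i]) (g : tens X X -> S)
    (w : seq X) : tens S X :=
  if w is [:: x; y; z] then g (x ⊗ y) ⊗ z else 0.

Record qmetric (X : coord_space) := QMetric {
  sigma : {linear tens X X -> tens X X};
  sigmai : {linear tens X X -> tens X X};
  Sig : star_alg R;
  metric : {linear tens X X -> Sig};
  gmx := \matrix_(i, j) metric (tnth (theta X) i ⊗ tnth (theta X) j);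
  ginv : 'M[Sig]_(vdim X);
  nu : {linear tens X Sig -> tens Sig X};
  nu_mx : Sig -> 'M[Sig]_(vdim X);
  sact : Sig -> G -> Sig;
  sco : {linear Sig -> tens Sig G};
  sigmaK : cancel sigma sigmai;
  sigmaiK : cancel sigmai sigma;
  sigma_braid : is_braid sigma;
  sigma_star : let star2 (t : tens X X) :=
      \tsum_(x ⊗ y <- t) vstar y ⊗ vstar x in
    forall t, star2 (sigma t) = sigma (star2 t);
  sigma_act : forall t a, sigma (act2 (@vact X) (@vact X) t a) =
                          act2 (@vact X) (@vact X) (sigma t) a;
  sigma_co : forall t, coact2 (vco X) (vco X) (sigma t) =
                       tmap sigma id (coact2 (vco X) (vco X) t);
  g_sigma : forall t, metric (sigma t) = metric t;
  g_star : forall x y, star (metric (x ⊗ y)) = metric (vstar y ⊗ vstar x);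
  gmx_inv : gmx *m ginv = 1%:M /\ ginv *m gmx = 1%:M;
  Sig_gen : forall s, gen_subalg *%R 1
    (fun r => exists i j, r = gmx i j \/ r = ginv i j) s;
  nu_mx1 : nu_mx 1 = 1%:M;
  nu_mxM : forall s t : Sig, nu_mx (s * t) = nu_mx s *m nu_mx t;
  nu_mxD : forall s t, nu_mx (s + t) = nu_mx s + nu_mx t;
  nu_mxZ : forall a s i j, nu_mx (a *: s) i j = a *: nu_mx s i j;
  nuE : forall i s, nu (tnth (theta X) i ⊗ s) =
                    \sum_j nu_mx s i j ⊗ tnth (theta X) j;
  nu_g : forall x y z, nu (x ⊗ metric (y ⊗ z)) =
    wlift (g_id_word metric) (at_pos sigma 1 (at_pos sigmai 0 (word [:: x; y; z])));
  gg_sigma : forall t, wlift (gg_word metric) t =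
    wlift (gg_word metric)
      (at_pos sigma 1 (at_pos sigmai 0 (at_pos sigma 2 (at_pos sigmai 1 t))));
  gg_sigma' : forall t, wlift (gg_word metric) t =
    wlift (gg_word metric)
      (at_pos sigma 1 (at_pos sigma 0 (at_pos sigmai 2 (at_pos sigmai 1 t))));
  sact_module : right_module sact;
  sact1 : forall a, sact 1 a = eps G a *: 1;
  sactM : forall (s t : Sig) a, sact (s * t) a =
    \tsum_(a1 ⊗ a2 <- cop G a) (sact s a1 * sact t a2);
  sact_g : forall x y a, sact (metric (x ⊗ y)) a =
    \tsum_(a1 ⊗ a2 <- cop G a) metric (vact x a1 ⊗ vact y a2);
  sco_coaction : coaction sco;
  sco1 : sco 1 = 1 ⊗ 1;
  scoM : forall s t : Sig, sco (s * t) = tmul (sco s) (sco t);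
  sco_g : forall x y,
    sco (metric (x ⊗ y)) = tmap metric id (coact2 (vco X) (vco X) (x ⊗ y));
  antisym_im : forall n (t : talg X), is_tensor n t ->
    (exists2 s, is_tensor n s & antisym sigma s = t) <->
    (forall i, (i.+1 < n)%N -> at_pos (@tau X) i t = - t) }.

(* The braided exterior algebra: the quotient of the tensor algebra by the    *)
(* kernel of the antisymmetrizer, given by its projection proj. The maps lact *)
(* and lco (multiplicative extensions) and lstar (graded) are determined by   *)
(* their values on V.                                                         *)
Definition lam_proj (X : lmodType R[i]) (L : algType R[i]) (lgen : X -> L) :
    talg X -> L :=
  wlift (fun w => \prod_(x <- w) lgen x).

Record ext_alg (X : coord_space) (Q : qmetric X) := ExtAlg {
  Lam : algType R[i];
  lgen : {linear X -> Lam};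
  proj := lam_proj lgen;
  lam_deg := fun n psi => exists2 t, is_tensor n t & proj t = psi;
  lact : Lam -> G -> Lam;
  lco : {linear Lam -> tens Lam G};
  lstar : Lam -> Lam;
  proj_surj : forall psi, exists t, proj t = psi;
  proj_ker : forall t, proj t = 0 <-> antisym (sigma Q) t = 0;
  lact_module : right_module lact;
  lact1 : forall a, lact 1 a = eps G a *: 1;
  lactM : forall (psi xi : Lam) a, lact (psi * xi) a =
    \tsum_(a1 ⊗ a2 <- cop G a) (lact psi a1 * lact xi a2);
  lact_lgen : forall x a, lact (lgen x) a = lgen (vact x a);
  lco_coaction : coaction lco;
  lco1 : lco 1 = 1 ⊗ 1;
  lcoM : forall psi xi : Lam, lco (psi * xi) = tmul (lco psi) (lco xi);
  lco_lgen : forall x, lco (lgen x) = tmap lgen id (vco X x);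
  lstar_antilinear : antilinear lstar;
  lstar1 : lstar 1 = 1;
  lstarM : forall m n psi xi, lam_deg m psi -> lam_deg n xi ->
    lstar (psi * xi) = (-1) ^+ (m * n) *: (lstar xi * lstar psi);
  lstar_lgen : forall x, lstar (lgen x) = lgen (vstar x) }.

Arguments proj {X Q} e.
Arguments lam_deg {X Q} e.

(* The pairing of Sig ⊗ T(V) with T(V): the last factor on the left is        *)
(* contracted with the first one on the right, and the resulting element of   *)
(* Sig acts on the right of the remaining left tensor. It vanishes on tensors *)
(* of different degrees.                                                      *)
Definition contract_word (X : lmodType R[i]) (S : algType R[i])
    (g : tens X X -> S) (nu : tens X S -> tens S X) (y : X) (w : seq X) :
    tens S (talg X) :=
  if w is x :: w' then nu_word nu (belast x w') (g (last x w' ⊗ y)) else 0.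

Fixpoint pair_word (X : lmodType R[i]) (S : algType R[i])
    (g : tens X X -> S) (nu : tens X S -> tens S X) (w : seq X)
    (Psi : tens S (talg X)) : S :=
  match w with
  | [::] => \tsum_(s ⊗ t <- Psi)
              (s * wlift (fun v => if v is [::] then 1 else 0 : S) t)
  | y :: w' => pair_word g nu w'
      (\tsum_(s ⊗ t <- Psi)
         tmap ( *%R s) id (wlift (contract_word g nu y) t))
  end.

(* g(psi, psi') for tensors psi, psi' over V *)
Definition pairing (X : lmodType R[i]) (S : algType R[i])
    (g : tens X X -> S) (nu : tens X S -> tens S X) (t t' : talg X) : S :=
  wlift (fun w => pair_word g nu w (1 ⊗ t)) t'.

Record clifford (X : coord_space) (Q : qmetric X) (E : ext_alg Q) := Clifford {
  (* All the maps below but clstar are the factorizations through Lam of maps *)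
  (* defined on tensors; nuL is the right action of Sig on Sig ⊗ Lam,         *)
  (* restricted to Lam.                                                       *)
  nuL : Lam E -> Sig Q -> tens (Sig Q) (Lam E);
  (* the identification of Lam with the image of the antisymmetrizer *)
  asL : {linear Lam E -> talg X};
  (* the coproduct phi and the pairing g on Lam; the former is extended to    *)
  (* Sig ⊗ Lam by left Sig-linearity                                          *)
  phiL : {linear Lam E -> tens (Lam E) (Lam E)};
  gL : Lam E -> Lam E -> Sig Q;
  clmul := fun Z W : tens (Sig Q) (Lam E) =>
    \tsum_(s ⊗ psi <- Z) \tsum_(psi1 ⊗ psi2 <- phiL psi)
    \tsum_(t ⊗ xi <- W) \tsum_(xi1 ⊗ xi2 <- phiL xi)
    \tsum_(t' ⊗ psi2' <- nuL psi2 t)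
    \tsum_(r ⊗ psi1' <- nuL psi1 (t' * gL psi2' xi1))
      (s * r) ⊗ (psi1' * xi2);
  clstar : tens (Sig Q) (Lam E) -> tens (Sig Q) (Lam E);
  nuL_proj : forall t s, nuL (proj E t) s =
    tmap id (proj E) (wlift (fun w => nu_word (nu Q) w s) t);
  asL_proj : forall t, asL (proj E t) = antisym (sigma Q) t;
  phiL_def : forall psi, tmap asL asL (phiL psi) = deconcatenation (asL psi);
  gL_def : forall t xi, gL (proj E t) xi = pairing (metric Q) (nu Q) t (asL xi);
  clstar_antilinear : antilinear clstar;
  clstarM : forall Z W, clstar (clmul Z W) = clmul (clstar W) (clstar Z);
  clstar_Sig : forall s, clstar (s ⊗ 1) = star s ⊗ 1;
  clstar_lgen : forall x, clstar (1 ⊗ lgen E x) = 1 ⊗ lgen E (vstar x) }.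

Section Horizontal.
Variables (P : qbundle) (X : coord_space) (Q : qmetric X) (E : ext_alg Q).

Definition hor : lmodType R[i] := tens (ptotal P) (Lam E).

Definition hor_mul (v w : hor) : hor :=
  \tsum_(q ⊗ psi <- v) \tsum_(b ⊗ xi <- w) \tsum_(b0 ⊗ c <- Fco P b)
    (q * b0) ⊗ (lact psi c * xi).

Definition hor_star (w : hor) : hor :=
  \tsum_(b ⊗ psi <- w) \tsum_(b0 ⊗ c <- Fco P b)
    star b0 ⊗ lact (lstar psi) (star c).

Definition hor_co : hor -> tens hor G := coact2 (Fco P) (lco E).

Definition hor_deg (n : nat) (w : hor) : Prop :=
  exists2 s : seq (ptotal P * Lam E),
    (forall p, p \in s -> lam_deg E n p.2) & w = \sum_(p <- s) p.1 ⊗ p.2.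

Record frame := Frame {
  nabla : {linear hor -> hor};
  fidx : finType;
  bfr : fidx -> {linear X -> ptotal P};
  ffr : fidx -> pbase P;
  partial : 'I_(vdim X) -> ptotal P -> ptotal P;
  nabla_deg : forall n w, hor_deg n w -> hor_deg n.+1 (nabla w);
  nabla_star : forall w, nabla (hor_star w) = hor_star (nabla w);
  nabla_leibniz : forall n v w, hor_deg n v ->
    nabla (hor_mul v w) = hor_mul (nabla v) w + (-1) ^+ n *: hor_mul v (nabla w);
  nabla_co : forall w, hor_co (nabla w) = tmap nabla id (hor_co w);
  nabla_vanish : forall w, gen_subalg hor_mul (1 ⊗ 1)
      (fun v => (exists f, v = nabla (inc P f ⊗ 1)) \/ (exists psi, v = 1 ⊗ psi)) w ->
    nabla w = 0;
  frame_coord : forall x, 1 ⊗ lgen E x =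
    \sum_a hor_mul (bfr a x ⊗ 1) (nabla (inc P (ffr a) ⊗ 1));
  bfr_co : forall a x, Fco P (bfr a x) = tmap (bfr a) id (vco X x);
  partialE : forall b,
    nabla (b ⊗ 1) = \sum_i partial i b ⊗ lgen E (tnth (theta X) i) }.

Record qmeasure (N : frame) := QMeasure {
  bhat : cstar_alg R;
  emb : {linear pbase P -> bhat};
  omega : {scalar bhat};
  vint : {linear ptotal P -> pbase P};
  omegaM := fun f => omega (emb f);
  omegaP := fun b => omegaM (vint b);
  emb1 : emb 1 = 1;
  embM : forall u v : pbase P, emb (u * v) = emb u * emb v;
  emb_star : forall u, emb (star u) = star (emb u);
  emb_inj : injective emb;
  emb_dense : forall x (e : R[i]), 0 < e -> exists u, cnorm (x - emb u) < e;
  omega1 : omega 1 = 1;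
  omega_ge0 : forall x, 0 <= omega (star x * x);
  omega_faithful : forall x, omega (star x * x) = 0 -> x = 0;
  vintE : forall b, inc P (vint b) = \tsum_(b0 ⊗ c <- Fco P b) (haar G c *: b0);
  vint_ge0 : forall b, exists y, emb (vint (star b * b)) = star y * y;
  vint_eq0 : forall b, vint (star b * b) = 0 -> b = 0;
  (* The sum below is invariant under the coaction, i.e. it lies in pbase P,  *)
  (* where omegaP restricts to omegaM.                                        *)
  homogeneous : forall (f : pbase P) (a : fidx N), omegaP
    (\sum_i \sum_j vdot X (tnth (theta X) j) ((Ck X)^-1%VF (tnth (theta X) i)) *:
       partial N i (bfr a (tnth (theta X) j) * inc P f)) = 0 }.

Record spinor (Cl : clifford E) := Spinor {
  spin : vectType R[i];
  sdot : scalar_product spin;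
  gam : {linear tens (Sig Q) (Lam E) -> 'End(spin)};
  spco : {linear spin -> tens spin G};
  gam1 : gam (1 ⊗ 1) = \1%VF;
  gamM : forall Z W, gam (clmul Cl Z W) = (gam Z \o gam W)%VF;
  gam_star : forall Z x y, sdot (gam Z x) y = sdot x (gam (clstar Cl Z) y);
  spin_neq0 : (fullv : {vspace spin}) != 0%VS;
  gam_irr : forall U : {vspace spin},
    (forall Z, (gam Z @: U <= U)%VS) -> U = 0%VS \/ U = fullv;
  spco_coaction : coaction spco;
  spco_unitary : invariant_product spco sdot;
  spco_gam : forall Z x, spco (gam Z x) =
    \tsum_(Z0 ⊗ c <- coact2 (sco Q) (lco E) Z) \tsum_(x0 ⊗ d <- spco x)
      gam Z0 x0 ⊗ (c * d) }.

Section Dirac.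
Variables (N : frame) (mu : qmeasure N) (Cl : clifford E) (S : spinor Cl).

Definition spinors : lmodType R[i] := tens (ptotal P) (spin S).

Definition spinors_co : spinors -> tens spinors G := coact2 (Fco P) (spco S).

Definition spinors_dot (psi phi : spinors) : R[i] :=
  \tsum_(b ⊗ x <- psi) \tsum_(q ⊗ y <- phi)
    (omegaP mu (star b * q) * sdot S x y).

Definition Dirac (psi : spinors) : spinors :=
  \tsum_(b ⊗ x <- psi)
    - 'i *: \sum_j partial N j b ⊗ gam S (1 ⊗ lgen E (tnth (theta X) j)) x.

End Dirac.
End Horizontal.
End OverGroup.

Arguments spinors_co {R G} P {X Q E Cl} S psi.
Arguments spinors_dot {R G P X Q E N} mu {Cl} S psi phi.
Arguments Dirac {R G P X Q E} N {Cl} S psi.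

(* Main.v *)
Require Import Defs.
From HB Require Import structures.
From mathcomp Require Import all_boot all_order all_algebra.
From mathcomp Require Import complex reals.
From mathcomp Require boolp.
Import GRing.Theory Num.Theory.
Local Open Scope ring_scope.

(* Covariance of the Dirac operator is that of [nabla], since                 *)
(* [D(b ⊗ x)] is [- 'i] times the Clifford action of [nabla b] on [x].        *)
(* For symmetry, apply [omega_P] to the Leibniz rule for [nabla (b^* q)]: as  *)
(* [omega_P] is invariant, the twisting by [vact] in the star of one-forms    *)
(* disappears, and everything reduces to [omega_P (partial_i b) = 0] for all  *)
(* [b]. Let [u] be the unitary matrix of [vco]. Averaging [b] against matrix  *)
(* coefficients gives, for each [k], an intertwiner [beta_k : V -> B], and    *)
(* every intertwiner is a combination of the [b_alpha] with coefficients in   *)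
(* the base, so that homogeneity applies to it. Covariance of [nabla] and     *)
(* [C^-1 u = kappa^2(u) C^-1] then turn homogeneity for [beta_k] into         *)
(* [\sum_s C^-1_ks omega_P (partial_s b) = 0], and [C] is invertible.         *)

(** A linear retraction [r] of [lgen], given by [lgen_retract], makes the coefficients of a one-form
    well defined, so that identities for [nabla] can be read off coordinate by coordinate.
    Covariance of the Dirac operator then combines [nabla_co] with the equivariance of the Clifford
    action, [spinors_co_hor_act]. Symmetry rests on the integration by parts [omegaP_parts], an
    identity between vectors of [V]: applying the functional [v |-> (x, gamma(v) y)] to it and
    multiplying by [- 'i] compares the two scalar products. Its main input is [omegaP_partial],
    which is assembled from [avg_frame] (intertwiners come from the frame), [omegaP_partial_avg]
    (the effect of averaging on the integrals) and [haar_Cki] (the averaging weights contract with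
    [C^-1] to [C^-1]). *)

Set Implicit Arguments.
Unset Strict Implicit.
Unset Printing Implicit Defensive.

(** * Linear algebra of the tensor product *)

Section Tensors.
Variable K : fieldType.
Implicit Types U V W : lmodType K.

Definition bilin U V W (f : U -> V -> W) : Prop :=
  (forall y, linear (f^~ y)) /\ (forall x, linear (f x)).

Lemma lin_add U W (f : U -> W) : linear f -> forall x y, f (x + y) = f x + f y.
Proof. by move=> fP x y; have := fP 1 x y; rewrite !scale1r. Qed.

Lemma lin_zero U W (f : U -> W) : linear f -> f 0 = 0.
Proof. by move=> fP; apply: (addrI (f 0)); rewrite -(lin_add fP) !addr0. Qed.

Lemma lin_scale U W (f : U -> W) : linear f -> forall a x, f (a *: x) = a *: f x.
Proof. by move=> fP a x; have := fP a x 0; rewrite (lin_zero fP) !addr0. Qed.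

Lemma lin_sum U W (f : U -> W) I (r : seq I) (E : I -> U) :
  linear f -> f (\sum_(i <- r) E i) = \sum_(i <- r) f (E i).
Proof.
by move=> fP; apply: (big_morph f); [exact: lin_add | exact: lin_zero].
Qed.

Lemma scalar_zero U (f : U -> K) : scalar f -> f 0 = 0.
Proof. exact: (@lin_zero U K^o). Qed.

Lemma scalar_scale U (f : U -> K) :
  scalar f -> forall a x, f (a *: x) = a * f x.
Proof. exact: (@lin_scale U K^o). Qed.

Lemma scalar_sum U (f : U -> K) I (r : seq I) (E : I -> U) :
  scalar f -> f (\sum_(i <- r) E i) = \sum_(i <- r) f (E i).
Proof. exact: (@lin_sum U K^o). Qed.

Lemma bilin_balanced U V W (f : U -> V -> W) : bilin f -> balanced f.
Proof.
move=> [fl fr]; split=> [x x' y|x y y'|a x y].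
- exact: (lin_add (fl y)).
- exact: (lin_add (fr x)).
- by rewrite (lin_scale (fl y)) (lin_scale (fr x)).
Qed.

Lemma tpure_bilin U V : bilin (fun (x : U) (y : V) => x ⊗ y).
Proof.
case: (tpure_balanced U V) => tl tr tZ.
by split=> [y a x x'|x a y y']; rewrite ?tl ?tr tpureZ// tZ.
Qed.

Lemma tpureDl U V (x x' : U) (y : V) : (x + x') ⊗ y = x ⊗ y + x' ⊗ y.
Proof. exact: (lin_add ((tpure_bilin U V).1 y)). Qed.

Lemma tpureDr U V (x : U) (y y' : V) : x ⊗ (y + y') = x ⊗ y + x ⊗ y'.
Proof. exact: (lin_add ((tpure_bilin U V).2 x)). Qed.

Lemma tpureZr U V a (x : U) (y : V) : x ⊗ (a *: y) = a *: (x ⊗ y).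
Proof. exact: (lin_scale ((tpure_bilin U V).2 x)). Qed.

Lemma tpureZl U V a (x : U) (y : V) : (a *: x) ⊗ y = a *: (x ⊗ y).
Proof. by rewrite tpureZ. Qed.

Lemma tpure_suml U V I (r : seq I) (E : I -> U) (y : V) :
  (\sum_(i <- r) E i) ⊗ y = \sum_(i <- r) E i ⊗ y.
Proof. exact: (lin_sum _ _ ((tpure_bilin U V).1 y)). Qed.

Lemma tpure_sumr U V I (r : seq I) (x : U) (E : I -> V) :
  x ⊗ (\sum_(i <- r) E i) = \sum_(i <- r) x ⊗ E i.
Proof. exact: (lin_sum _ _ ((tpure_bilin U V).2 x)). Qed.

(** [tlift] sums over a chosen representative of [t], so operations on the summand that keep [t]
    fixed pass through it termwise; the same holds for [tlift_map], [eq_tlift] and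
    [tlift_linearf]. *)
Lemma tlift_addf U V (W : zmodType) (t : tens U V) (f g : U -> V -> W) :
  tlift t (fun x y => f x y + g x y) = tlift t f + tlift t g.
Proof. by rewrite /tlift /plift big_split. Qed.

Lemma tlift_map U V (W W' : zmodType) (t : tens U V) (f : U -> V -> W)
    (h : W -> W') :
  h 0 = 0 -> {morph h : x y / x + y} ->
  h (tlift t f) = tlift t (fun x y => h (f x y)).
Proof. by move=> h0 hD; rewrite /tlift /plift; exact: (big_morph h). Qed.

Lemma eq_tlift U V (W : zmodType) (t : tens U V) (f g : U -> V -> W) :
  (forall x y, f x y = g x y) -> tlift t f = tlift t g.
Proof. by move=> fg; rewrite /tlift /plift; apply: eq_bigr=> *; rewrite fg. Qed.

Lemma tlift_sum U V (W : zmodType) (f : U -> V -> W) I (r : seq I)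
    (E : I -> tens U V) :
  balanced f -> tlift (\sum_(i <- r) E i) f = \sum_(i <- r) tlift (E i) f.
Proof.
move=> fP; apply: (big_morph (fun t => tlift t f)); first exact: tliftD.
by apply: (addrI (tlift 0 f)); rewrite -tliftD// !addr0.
Qed.

Lemma tlift_linear U V W (f : U -> V -> W) :
  bilin f -> linear (fun t => tlift t f).
Proof.
move=> fB a s t; have fP := bilin_balanced fB.
rewrite tliftD//; congr (_ + _).
have [r ->] := tens_sum s; rewrite scaler_sumr !tlift_sum// scaler_sumr.
by apply: eq_bigr=> p _; rewrite tpureZ !tliftE// (lin_scale (fB.1 _)).
Qed.

Lemma tlift_linearf U V W W' (m : W -> U -> V -> W') (t : tens U V) :
  (forall x y, linear (fun w => m w x y)) -> linear (fun w => tlift t (m w)).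
Proof.
move=> mP a w w'; rewrite /tlift /plift scaler_sumr -big_split.
by apply: eq_bigr=> p _; rewrite mP.
Qed.

(** Pure tensors span. Most tensor identities below are proved this way, one tensor variable at a
    time. *)
Lemma tens_linear_ext U V W (f g : tens U V -> W) :
  linear f -> linear g -> (forall x y, f (x ⊗ y) = g (x ⊗ y)) -> f =1 g.
Proof.
move=> fP gP fg t; have [s ->] := tens_sum t.
by rewrite !lin_sum//; apply: eq_bigr=> p _; exact: fg.
Qed.

Lemma linear_comp U V W (f : U -> V) (g : V -> W) :
  linear f -> linear g -> linear (fun x => g (f x)).
Proof. by move=> fP gP a x y; rewrite fP gP. Qed.

Lemma bilin_comp U V U' V' W (f : U -> V -> W) (h : U' -> U) (k : V' -> V) :
  bilin f -> linear h -> linear k -> bilin (fun x y => f (h x) (k y)).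
Proof. by move=> [fl fr] hP kP; split=> [y|x] a u v; rewrite ?hP ?kP (fl, fr). Qed.

Lemma bilin_post U V W W' (f : U -> V -> W) (h : W -> W') :
  bilin f -> linear h -> bilin (fun x y => h (f x y)).
Proof. by move=> [fl fr] hP; split=> [y|x] a u v; rewrite (fl, fr) hP. Qed.

Lemma tlift2_bilin (A B A' B' W : lmodType K) (m : A -> B -> A' -> B' -> W) :
  (forall a b, bilin (m a b)) -> (forall a' b', bilin (fun a b => m a b a' b')) ->
  bilin (fun s t => tlift s (fun a b => tlift t (m a b))).
Proof.
move=> mr ml; split=> [t|s].
  apply: tlift_linear; split=> [b|a]; apply: tlift_linearf=> a' b'.
    exact: (ml a' b').1.
  exact: (ml a' b').2.
apply: (@tlift_linearf A B (tens A' B') W (fun t a b => tlift t (m a b))).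
by move=> a b; exact: tlift_linear.
Qed.

Lemma tlift2E (A B A' B' W : lmodType K) (m : A -> B -> A' -> B' -> W)
    a b a' b' :
  (forall a b, bilin (m a b)) -> (forall a' b', bilin (fun a b => m a b a' b')) ->
  tlift (a ⊗ b) (fun a b => tlift (a' ⊗ b') (m a b)) = m a b a' b'.
Proof.
move=> mr ml; rewrite tliftE; first by rewrite tliftE//; exact: bilin_balanced.
apply: bilin_balanced; split=> [y|x]; apply: tlift_linearf=> u v.
  exact: (ml u v).1.
exact: (ml u v).2.
Qed.

Section Tmap.
Variables (U V U' V' : lmodType K) (f : U -> U') (g : V -> V').
Hypotheses (fP : linear f) (gP : linear g).

Lemma tmap_bilin : bilin (fun x y => f x ⊗ g y).
Proof. exact: bilin_comp (tpure_bilin _ _) fP gP. Qed.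

Lemma tmap_linear : linear (tmap f g).
Proof. exact: tlift_linear tmap_bilin. Qed.

Lemma tmapE x y : tmap f g (x ⊗ y) = f x ⊗ g y.
Proof. by rewrite /tmap tliftE//; exact: bilin_balanced tmap_bilin. Qed.

End Tmap.

Lemma linear_id U : linear (fun x : U => x).
Proof. by []. Qed.

Section Tassoc.
Variables U V W : lmodType K.

Lemma tassoc_bilin : bilin (fun (r : tens U V) (z : W) => tlift r (fun x y => x ⊗ (y ⊗ z))).
Proof.
split=> [z|r].
  apply: tlift_linear; split=> [y|x] a u v.
    exact: (tpure_bilin _ _).1.
  by rewrite tpureDl tpureDr tpureZl tpureZr.
apply: tlift_linearf=> x y a u v.
by rewrite !tpureDr !tpureZr.
Qed.

Lemma tassoc_linear : linear (@tassoc K U V W).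
Proof. exact: tlift_linear tassoc_bilin. Qed.

Lemma tassocE x y z : @tassoc K U V W (x ⊗ y ⊗ z) = x ⊗ (y ⊗ z).
Proof.
rewrite /tassoc tliftE; last exact: bilin_balanced tassoc_bilin.
rewrite tliftE//; split=> *; rewrite ?tpureDl ?tpureDr ?tpureZl ?tpureZr//.
Qed.

End Tassoc.

Section Products.
Variables A B : algType K.

Lemma mulr_bilin : bilin (fun x y : A => x * y).
Proof. by split=> [y|x] a u v /=; rewrite (mulrDl, mulrDr) -?scalerAl -?scalerAr. Qed.

Lemma tmul_bilinr (a : A) (b : B) : bilin (fun a' b' => (a * a') ⊗ (b * b')).
Proof.
by split=> [y|x] c u v; rewrite mulrDr -scalerAr (tpureDl, tpureDr) (tpureZl, tpureZr).
Qed.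

Lemma tmul_bilinl (a' : A) (b' : B) : bilin (fun a b => (a * a') ⊗ (b * b')).
Proof.
by split=> [y|x] c u v; rewrite mulrDl -scalerAl (tpureDl, tpureDr) (tpureZl, tpureZr).
Qed.

Lemma tmul_bilin : bilin (@tmul K A B).
Proof. exact: tlift2_bilin tmul_bilinr tmul_bilinl. Qed.

Lemma tmulE a b a' b' : @tmul K A B (a ⊗ b) (a' ⊗ b') = (a * a') ⊗ (b * b').
Proof. exact: tlift2E tmul_bilinr tmul_bilinl. Qed.

End Products.

Section Coact2.
Variables (A : algType K) (U V : lmodType K).

(* [coact2] before composing with the two coactions *)
Definition tmul13 (s : tens U A) (t : tens V A) : tens (tens U V) A :=
  \tsum_(x ⊗ c <- s) \tsum_(y ⊗ d <- t) (x ⊗ y) ⊗ (c * d).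

Lemma tmul13_bilinr x c :
  bilin (fun (y : V) (d : A) => (x ⊗ y : tens U V) ⊗ (c * d)).
Proof.
by split=> [y|z] a u v; rewrite ?mulrDr ?tpureDr ?tpureDl -?scalerAr ?tpureZr ?tpureZl.
Qed.

Lemma tmul13_bilinl y d :
  bilin (fun (x : U) (c : A) => (x ⊗ y : tens U V) ⊗ (c * d)).
Proof.
by split=> [z|x] a u v; rewrite ?mulrDl ?tpureDl ?tpureDr -?scalerAl ?tpureZr ?tpureZl ?tpureDl ?tpureZl.
Qed.

Lemma tmul13_bilin : bilin tmul13.
Proof. exact: tlift2_bilin tmul13_bilinr tmul13_bilinl. Qed.

Lemma tmul13E x c y d : tmul13 (x ⊗ c) (y ⊗ d) = (x ⊗ y) ⊗ (c * d).
Proof. exact: tlift2E tmul13_bilinr tmul13_bilinl. Qed.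

Variables (f : U -> tens U A) (g : V -> tens V A).
Hypotheses (fP : linear f) (gP : linear g).

Lemma coact2_linear : linear (coact2 f g).
Proof. exact: tlift_linear (bilin_comp tmul13_bilin fP gP). Qed.

Lemma coact2E x y : coact2 f g (x ⊗ y) = tmul13 (f x) (g y).
Proof.
by rewrite /coact2 tliftE//; exact: bilin_balanced (bilin_comp tmul13_bilin fP gP).
Qed.

End Coact2.
End Tensors.

(** * Tensor words and the embedding of [V] in the exterior algebra *)

Section Words.
Variables (K : fieldType) (V W : lmodType K).

Definition wmultilinear (f : seq V -> W) : Prop :=
  (forall s x y t, f (s ++ (x + y) :: t) = f (s ++ x :: t) + f (s ++ y :: t)) /\
  (forall b s x t, f (s ++ (b *: x) :: t) = b *: f (s ++ x :: t)).

Variable f : seq V -> W.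
Hypothesis fP : wmultilinear f.

Lemma wlift_compat : multilinear (fun p : K * seq V => p.1 *: f p.2).
Proof.
case: fP => fD fZ; split=> [a b w|a s x y t|a b s x t] /=.
- by rewrite scalerDl.
- by rewrite fD scalerDr.
- by rewrite fZ scalerA.
Qed.

Lemma wlift_word w : wlift f (word w) = f w.
Proof. by rewrite /wlift pliftE ?scale1r//; exact: wlift_compat. Qed.

Lemma wlift_linear : linear (wlift f).
Proof.
move=> a s t; rewrite /wlift plift_is_additive; last exact: wlift_compat.
congr (_ + _); rewrite [LHS](@plift_scal K (talg_presentation V)); last exact: wlift_compat.
rewrite /plift scaler_sumr; apply: eq_bigr=> p _ /=; exact/esym/scalerA.
Qed.

End Words.

Lemma word1_linear (K : fieldType) (V : lmodType K) :
  linear (fun x : V => word [:: x]).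
Proof.
move=> a x y; apply: presented_ext=> W f fP.
rewrite plift_is_additive// [in RHS](@plift_scal K (talg_presentation V))//.
rewrite /word !pliftE//; last exact: compatZ.
case: fP=> fD fV fZ.
by rewrite (fV _ [::]) (fZ _ _ [::]) mul1r/= mulr1.
Qed.

Section Embedding.
Variables (R : realType) (G : cmqg R) (X : coord_space G) (Q : qmetric X)
  (E : ext_alg Q) (Cl : clifford E).

Definition deg1_word (w : seq X) : X := if w is [:: x] then x else 0.

Lemma deg1_word_multilinear : wmultilinear deg1_word.
Proof.
by split=> [[|? [|? s]] x y [|? t]|b [|? [|? s]] x [|? t]] //=;
   rewrite ?addr0 ?scaler0.
Qed.

Lemma lgen_word_multilinear :
  wmultilinear (fun w : seq X => \prod_(x <- w) lgen E x).
Proof.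
by split=> [s x y t|b s x t]; rewrite !big_cat !big_cons/=;
   rewrite ?linearD ?linearZ /= -?scalerAl -?scalerAr ?mulrDl ?mulrDr.
Qed.

Lemma proj_word w : proj E (word w) = \prod_(x <- w) lgen E x.
Proof. exact: wlift_word lgen_word_multilinear _. Qed.

Lemma tensor1_word (t : talg X) : is_tensor 1 t -> exists x, t = word [:: x].
Proof.
move=> [s sP ->]; exists (\sum_(p <- s) p.1 *: deg1_word p.2).
rewrite (lin_sum _ _ (@word1_linear _ _)); apply: eq_big_seq=> p /(allP sP).
rewrite (lin_scale (@word1_linear _ _)).
by case: (p.2) => [|x []].
Qed.

(** The degree one component of a form, seen through the identification of the exterior algebra with
    the image of the antisymmetrizer. *)
Definition deg1L (psi : Lam E) : X := wlift deg1_word (asL Cl psi).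

Lemma deg1L_linear : linear deg1L.
Proof.
by move=> a u v; rewrite /deg1L linearP (wlift_linear deg1_word_multilinear).
Qed.

Lemma deg1L_lgen_surj y : exists x, deg1L (lgen E x) = y.
Proof.
have y1 : is_tensor 1 (word [:: y]).
  by exists [:: (1, [:: y])]; rewrite ?big_seq1 ?scale1r.
(* A word of one letter has no adjacent pair, so the braid condition of [antisym_im] is vacuous in
   degree one. *)
have [_ im1] := antisym_im Q y1.
have /im1[_ /tensor1_word[z ->] zE] : forall i, (i.+1 < 1)%N ->
  at_pos (@tau _ _ X) i (word [:: y]) = - word [:: y] by [].
exists z; rewrite /deg1L.
have -> : lgen E z = proj E (word [:: z]) by rewrite proj_word big_seq1.
by rewrite asL_proj zE (wlift_word deg1_word_multilinear).
Qed.

Lemma deg1L_lgen_linear : linear (fun x : X => deg1L (lgen E x)).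
Proof. exact: (linear_comp (linearP (lgen E)) deg1L_linear). Qed.

(* The antisymmetrizer maps the degree one tensors onto themselves, hence [V] *)
(* embeds into the exterior algebra; finite-dimensionality avoids computing   *)
(* the antisymmetrizer of a one-letter word.                                  *)
Lemma lgen_retract : exists r : Lam E -> X, linear r /\ cancel (lgen E) r.
Proof.
pose lf := HB.pack (fun x : X => deg1L (lgen E x))
  (GRing.isLinear.Build _ _ _ _ _ deg1L_lgen_linear) : {linear X -> X}.
pose T : 'End(X) := linfun lf.
have TE x : T x = deg1L (lgen E x) by rewrite lfunE.
have T_img : limg T = fullv.
  apply/vspaceP=> y; rewrite memvf.
  have [x <-] := deg1L_lgen_surj y; rewrite -TE; exact/memv_img/memvf.
(* Rank-nullity: a surjective endomorphism of [V] is injective. *)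
have T_ker : lker T == 0%VS.
  rewrite -dimv_eq0 -(eqn_add2r (\dim (limg T))) -{1}[lker T]capfv.
  by rewrite limg_ker_dim T_img add0n.
exists (fun psi => (T^-1)%VF (deg1L psi)); split.
  by move=> a u v; rewrite deg1L_linear linearP.
by move=> x; rewrite -TE lker0_lfunK.
Qed.

End Embedding.

(** * Contractions and matrix coefficients *)

Section Contractions.
Variable K : fieldType.
Implicit Types U V W : lmodType K.

(** The slice maps [phi ⊗ id] and [id ⊗ psi]. *)
Definition contrl U V (phi : U -> K) (t : tens U V) : V :=
  \tsum_(x ⊗ y <- t) (phi x *: y).
Definition contrr U V (psi : V -> K) (t : tens U V) : U :=
  \tsum_(x ⊗ y <- t) (psi y *: x).

Lemma contrl_bilin U V (phi : U -> K) :
  scalar phi -> bilin (fun x (y : V) => phi x *: y).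
Proof.
move=> phiP; split=> [y|x] a u v; first by rewrite phiP scalerDl scalerA.
by rewrite scalerDr !scalerA mulrC.
Qed.

Lemma contrr_bilin U V (psi : V -> K) :
  scalar psi -> bilin (fun (x : U) y => psi y *: x).
Proof. by move=> /(@contrl_bilin V U)[sl sr]; split. Qed.

Lemma contrl_linear U V (phi : U -> K) :
  scalar phi -> linear (@contrl U V phi).
Proof. by move=> /(@contrl_bilin _ V)/tlift_linear. Qed.

Lemma contrr_linear U V (psi : V -> K) :
  scalar psi -> linear (@contrr U V psi).
Proof. by move=> /(@contrr_bilin U)/tlift_linear. Qed.

Lemma contrlE U V (phi : U -> K) x (y : V) :
  scalar phi -> contrl phi (x ⊗ y) = phi x *: y.
Proof.
by move=> phiP; exact: tliftE (bilin_balanced (contrl_bilin V phiP)).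
Qed.

Lemma contrrE U V (psi : V -> K) (x : U) y :
  scalar psi -> contrr psi (x ⊗ y) = psi y *: x.
Proof.
by move=> psiP; exact: tliftE (bilin_balanced (contrr_bilin U psiP)).
Qed.

Lemma tmap_comp U V U' V' U'' V'' (f : U -> U') (g : V -> V')
    (f' : U' -> U'') (g' : V' -> V'') t :
  linear f -> linear g -> linear f' -> linear g' ->
  tmap f' g' (tmap f g t) = tmap (fun x => f' (f x)) (fun y => g' (g y)) t.
Proof.
move=> fP gP f'P g'P.
have f'fP := linear_comp fP f'P; have g'gP := linear_comp gP g'P.
apply: (tens_linear_ext (linear_comp (tmap_linear fP gP) (tmap_linear f'P g'P))).
  exact: tmap_linear.
by move=> x y; rewrite !tmapE.
Qed.

Lemma tmap_contrl_tassoc U V W (phi : V -> K) (t : tens (tens U V) W) :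
  scalar phi -> tmap id (contrl phi) (tassoc t) = tmap (contrr phi) id t.
Proof.
move=> phiP; have lP := @contrl_linear V W _ phiP; have rP := @contrr_linear U V _ phiP.
have lT := linear_comp (@tassoc_linear _ U V W) (tmap_linear (@linear_id _ U) lP).
have rT := tmap_linear rP (@linear_id _ W).
apply: (tens_linear_ext lT rT) => s z.
have tz := (@tpure_bilin _ (tens U V) W).1 z.
apply: (tens_linear_ext (linear_comp tz lT) (linear_comp tz rT)) => x y.
by rewrite tassocE !tmapE ?contrlE ?contrrE// tpureZr tpureZl.
Qed.

Lemma tmap_contrr_tassoc U V W (psi : W -> K) (t : tens (tens U V) W) :
  scalar psi -> tmap id (contrr psi) (tassoc t) = contrr psi t.
Proof.
move=> psiP; have rP := @contrr_linear V W _ psiP.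
have lT := linear_comp (@tassoc_linear _ U V W) (tmap_linear (@linear_id _ U) rP).
have rT := @contrr_linear (tens U V) W _ psiP.
apply: (tens_linear_ext lT rT) => s z.
have tz := (@tpure_bilin _ (tens U V) W).1 z.
apply: (tens_linear_ext (linear_comp tz lT) (linear_comp tz rT)) => x y.
by rewrite tassocE !tmapE ?contrrE// tpureZr.
Qed.

Lemma contrl_tmap U V U' (f : U -> U') (phi : U' -> K) (t : tens U V) :
  linear f -> scalar phi ->
  contrl phi (tmap f id t) = contrl (fun x => phi (f x)) t.
Proof.
move=> fP phiP; have fphiP : scalar (fun x => phi (f x)).
  by move=> a x y; rewrite fP phiP.
have fT := tmap_linear fP (@linear_id _ V).
apply: (tens_linear_ext (linear_comp fT (contrl_linear phiP)) (contrl_linear fphiP)).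
by move=> x y; rewrite tmapE// !contrlE.
Qed.

Lemma contrl_tmapr U V V' (g : V -> V')
    (phi : U -> K) (t : tens U V) :
  linear g -> scalar phi -> contrl phi (tmap id g t) = g (contrl phi t).
Proof.
move=> gP phiP.
have gT := tmap_linear (@linear_id _ U) gP.
apply: (tens_linear_ext (linear_comp gT (contrl_linear phiP))
                        (linear_comp (contrl_linear phiP) gP)) => x y.
by rewrite tmapE// !contrlE// (lin_scale gP).
Qed.

Lemma contrr_tmap U V U' (f : U -> U') (psi : V -> K) (t : tens U V) :
  linear f -> scalar psi ->
  contrr psi (tmap f id t) = f (contrr psi t).
Proof.
move=> fP psiP.
have fT := tmap_linear fP (@linear_id _ V).
apply: (tens_linear_ext (linear_comp fT (contrr_linear psiP))
                        (linear_comp (contrr_linear psiP) fP)) => x y.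
by rewrite tmapE// !contrrE// (lin_scale fP).
Qed.

Lemma tmap_contrr_const U V (A : algType K) (psi : V -> K) (t : tens U V) :
  scalar psi -> tmap id (fun y => psi y *: (1 : A)) t = contrr psi t ⊗ 1.
Proof.
move=> psiP; have cP : linear (fun y => psi y *: (1 : A)).
  by move=> a u v; rewrite psiP scalerDl scalerA.
apply: (tens_linear_ext (tmap_linear (@linear_id _ U) cP)
  (linear_comp (contrr_linear psiP) ((tpure_bilin U A).1 1))) => x y.
by rewrite tmapE ?contrrE// tpureZr tpureZl.
Qed.

Lemma contrl_tmul1 (A B : algType K) (phi : A -> K) (t : tens A B) u :
  scalar phi -> contrl phi (tmul t (1 ⊗ u)) = contrl phi t * u.
Proof.
move=> phiP; have cP := @contrl_linear A B _ phiP.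
apply: (tens_linear_ext (linear_comp ((tmul_bilin A B).1 _) cP)
  (linear_comp cP ((mulr_bilin B).1 u))) => x y.
by rewrite tmulE mulr1 !contrlE// scalerAl.
Qed.

(** [1 ⊗ u] and [b ⊗ 1] commute. Moving the group factor next to [t] brings products into the form
    to which [partial_Fco] applies. *)
Lemma tmul_split (A B : algType K) (t : tens A B) b u :
  tmul t (b ⊗ u) = tmul (tmul t (1 ⊗ u)) (b ⊗ 1).
Proof.
apply: (tens_linear_ext ((tmul_bilin A B).1 _)
  (linear_comp ((tmul_bilin A B).1 _) ((tmul_bilin A B).1 _))) => x y.
by rewrite !tmulE !mulr1.
Qed.

Lemma contrr_tmul (A B : algType K) (psi : B -> K) (t : tens A B) x y :
  scalar psi ->
  contrr psi (tmul t (x ⊗ y)) = contrr (fun b => psi (b * y)) t * x.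
Proof.
move=> psiP; have psiyP : scalar (fun b => psi (b * y)).
  by move=> a u v; rewrite mulrDl -scalerAl psiP.
have cP := @contrr_linear A B _ psiP; have cyP := @contrr_linear A B _ psiyP.
apply: (tens_linear_ext (linear_comp ((tmul_bilin A B).1 _) cP)
  (linear_comp cyP ((mulr_bilin A).1 x))) => u v.
by rewrite tmulE !contrrE// scalerAl.
Qed.

End Contractions.

Section Coordinates.
Variables (R : realType) (G : cmqg R) (X : coord_space G).

Local Notation th := (tnth (theta X)).
Local Notation d := (vdim X).

Definition crd (i : 'I_d) (x : X) : R[i] := coord (theta X) i x.

Lemma crd_scalar i : scalar (crd i).
Proof. exact: linearP. Qed.

Lemma crdE x : x = \sum_i crd i x *: th i.
Proof.
rewrite {1}(coord_basis (theta_basis X) (memvf x)).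
by apply: eq_bigr=> i _; rewrite (tnth_nth 0).
Qed.

Lemma crd_th i j : crd i (th j) = (i == j)%:R.
Proof.
rewrite /crd (tnth_nth 0) coord_free; first by rewrite eq_sym.
exact: basis_free (theta_basis X).
Qed.

Lemma dot_crd i x : vdot X (th i) x = crd i x.
Proof.
rewrite {1}[x]crdE; set p := vdot X.
have pP : scalar (p (th i)) by move=> a u v; rewrite dotDr dotZr.
rewrite (scalar_sum _ _ pP) (bigD1 i)//= big1 ?addr0.
  by rewrite dotZr theta_ortho eqxx mulr1.
by move=> j ji; rewrite dotZr theta_ortho eq_sym (negPf ji) mulr0.
Qed.

(** The matrix of the coaction in the orthonormal basis, see [vco_th]. *)
Definition umx (i j : 'I_d) : G := contrl (crd i) (vco X (th j)).

Lemma tens_crdE (W : lmodType R[i]) (t : tens X W) :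
  t = \sum_i th i ⊗ contrl (crd i) t.
Proof.
have cP i := contrl_linear (V := W) (crd_scalar i).
have sP : linear (fun t : tens X W => \sum_i th i ⊗ contrl (crd i) t).
  move=> a u v; rewrite scaler_sumr -big_split.
  by apply: eq_bigr=> i _; rewrite cP tpureDr tpureZr.
apply: (tens_linear_ext (@linear_id _ _) sP) => x y.
rewrite {1}[x]crdE tpure_suml; apply: eq_bigr=> i _.
by rewrite contrlE ?tpureZl ?tpureZr//; exact: crd_scalar.
Qed.

Lemma vco_th j : vco X (th j) = \sum_i th i ⊗ umx i j.
Proof. exact: tens_crdE. Qed.

Lemma contrl_crd_sum (W : lmodType R[i]) i (E : 'I_d -> W) :
  contrl (crd i) (\sum_k th k ⊗ E k) = E i.
Proof.
rewrite (lin_sum _ _ (contrl_linear (crd_scalar i))) (bigD1 i)//= big1 ?addr0.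
  by rewrite contrlE ?crd_th ?eqxx ?scale1r//; exact: crd_scalar.
move=> k ki; rewrite contrlE ?crd_th; last exact: crd_scalar.
by rewrite eq_sym (negPf ki) scale0r.
Qed.

Lemma sum_delta_scale (W : lmodType R[i]) i (E : 'I_d -> W) :
  \sum_k (i == k)%:R *: E k = E i.
Proof.
rewrite (bigD1 i)//= big1 ?addr0 ?eqxx ?scale1r// => k.
by rewrite eq_sym => /negPf->; rewrite scale0r.
Qed.

Let vcoP : linear (vco X) := linearP (vco X).
Let copP : linear (cop G) := linearP (cop G).

(** Compare the coefficients of [th i] in the coassociativity of the coaction at [th j]. *)
Lemma cop_umx i j : cop G (umx i j) = \sum_m umx i m ⊗ umx m j.
Proof.
have [/(_ (th j)) + _] := vco_coaction X.
rewrite vco_th !(lin_sum _ _ (tmap_linear _ _))//.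
rewrite (lin_sum _ _ (@tassoc_linear _ _ _ _)) => coassoc.
have := congr1 (contrl (crd i)) coassoc.
have -> : \sum_m tmap id (cop G) (th m ⊗ umx m j) = \sum_m th m ⊗ cop G (umx m j).
  by apply: eq_bigr=> m _; rewrite (tmapE (@linear_id _ _) copP).
rewrite contrl_crd_sum => <-; rewrite (lin_sum _ _ (contrl_linear (crd_scalar i))).
apply: eq_bigr=> m _; rewrite (tmapE vcoP (@linear_id _ _)) vco_th tpure_suml.
rewrite (lin_sum _ _ (@tassoc_linear _ _ _ _)).
rewrite (eq_bigr (fun k => th k ⊗ (umx k m ⊗ umx m j))) ?contrl_crd_sum//.
by move=> k _; rewrite tassocE.
Qed.

Lemma eps_umx i j : eps G (umx i j) = (i == j)%:R.
Proof.
have epsP : scalar (eps G) := linearP (eps G).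
have [_ /(_ (th j))] := vco_coaction X.
rewrite -/(contrr (eps G) _) vco_th (lin_sum _ _ (contrr_linear epsP)).
move=> /(congr1 (crd i)); rewrite crd_th => <-.
rewrite (scalar_sum _ _ (@crd_scalar i)).
rewrite -[LHS]/((eps G (umx i j) : R[i]^o)).
rewrite -[LHS](sum_delta_scale (W := R[i]^o) i (fun k => eps G (umx k j))).
apply: eq_bigr=> k _; rewrite contrrE//.
rewrite (scalar_scale (@crd_scalar i)) crd_th.
exact: mulrC.
Qed.

Lemma antip_umxl i j : \sum_m antip G (umx i m) * umx m j = (i == j)%:R.
Proof.
have mP : bilin (fun a b : G => antip G a * b).
  exact: bilin_comp (@mulr_bilin _ G) (linearP (antip G)) (@linear_id _ _).
have := antipl (umx i j); rewrite cop_umx eps_umx (lin_sum _ _ (tlift_linear mP)).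
rewrite scaler_nat => <-; apply: eq_bigr=> m _.
by rewrite tliftE//; exact: bilin_balanced.
Qed.

Lemma antip_umxr i j : \sum_m umx i m * antip G (umx m j) = (i == j)%:R.
Proof.
have mP : bilin (fun a b : G => a * antip G b).
  exact: bilin_comp (@mulr_bilin _ G) (@linear_id _ _) (linearP (antip G)).
have := antipr (umx i j); rewrite cop_umx eps_umx (lin_sum _ _ (tlift_linear mP)).
rewrite scaler_nat => <-; apply: eq_bigr=> m _.
by rewrite tliftE//; exact: bilin_balanced.
Qed.

(** Invariance of the scalar product, evaluated on two vectors of the orthonormal basis. *)
Lemma umx_unitary i j : \sum_m star (umx m i) * umx m j = (i == j)%:R.
Proof.
have [sD sZ] := star_antilinear (pol G).
have := vdot_inv (th i) (th j); rewrite theta_ortho scaler_nat => <-.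
have rP x c : bilin (fun y e => vdot X x y *: (star c * e : G)).
  split=> [e|y] a u v.
    by rewrite dotDr dotZr scalerDl scalerA.
  by rewrite mulrDr scalerDr -scalerAr !scalerA mulrC.
(* The expression is antilinear in both [x] and [c]: the two conjugations cancel in the balancing
   condition, but it is not bilinear. *)
have lP t : balanced (fun x c => \tsum_(y ⊗ e <- t) (vdot X x y *: (star c * e : G))).
  split=> [x x' c|x c c'|a x c].
  - rewrite -tlift_addf; apply: eq_tlift=> y e.
    by rewrite -scalerDl dot_conj dotDr rmorphD/= -!dot_conj.
  - rewrite -tlift_addf; apply: eq_tlift=> y e.
    by rewrite sD mulrDl scalerDr.
  apply: eq_tlift=> y e.
  by rewrite sZ -scalerAl scalerA dot_conj dotZr rmorphM/= -dot_conj mulrC.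
rewrite !vco_th (tlift_sum _ _ (lP _)); apply: eq_bigr=> m _.
rewrite (tliftE _ _ (lP _)).
rewrite (lin_sum _ _ (tlift_linear (rP _ _))) -[LHS](sum_delta_scale m (fun k => star (umx m i) * umx k j)).
apply: eq_bigr=> k _; rewrite (tliftE _ _ (bilin_balanced (rP _ _))).
by rewrite theta_ortho.
Qed.

(* Both sides are one-sided inverses of the matrix [umx]. *)
Lemma antip_umx i j : antip G (umx i j) = star (umx j i).
Proof.
have -> : antip G (umx i j) = \sum_k (i == k)%:R *: antip G (umx k j).
  by rewrite sum_delta_scale.
under eq_bigr=> k _ do rewrite scaler_nat -[antip _ _]mul1r -mulrnAl -umx_unitary mulr_suml.
rewrite exchange_big -[RHS](sum_delta_scale j (fun k => star (umx k i)))/=.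
apply: eq_bigr=> m _.
under eq_bigr=> k _ do rewrite -mulrA.
by rewrite -mulr_sumr antip_umxr eq_sym -scaler_nat -scalerAr mulr1.
Qed.

(** Since [antip] acts on matrix coefficients as the star of the transpose, this follows from the
    coproduct respecting stars. *)
Lemma cop_antip_umx i j :
  cop G (antip G (umx i j)) = \sum_m antip G (umx m j) ⊗ antip G (umx i m).
Proof.
have [_ _ cop_star] := cop_hom G.
have [sD sZ] := star_antilinear (pol G).
have tP : balanced (fun a b : G => star a ⊗ star b).
  by split=> *; rewrite ?sD ?sZ ?tpureDl ?tpureDr ?tpureZl ?tpureZr.
rewrite antip_umx cop_star cop_umx /tstar tlift_sum//.
by apply: eq_bigr=> m _; rewrite tliftE// !antip_umx.
Qed.

Local Notation hk i j := (fun c => haar G (c * antip G (umx i j))).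

Lemma haar_mul_scalar (e : G) : scalar (fun c => haar G (c * e)).
Proof. by move=> a u v; rewrite mulrDl -scalerAl linearP. Qed.

(** Expand [h(c kappa(u_ik)) 1] by the invariance of the Haar state, multiply by [u_kj] on the right
    and sum over [k]: the relation [kappa(u) u = 1] leaves only the required term. *)
Lemma haar_umx i j c :
  contrr (hk i j) (cop G c) = \sum_k hk i k c *: umx k j.
Proof.
have [_ copM _] := cop_hom G.
have hP : scalar (haar G) := linearP (haar G).
have E k : hk i k c *: umx k j =
    \sum_m contrr (hk i m) (cop G c) * (antip G (umx m k) * umx k j).
  have -> : hk i k c *: umx k j = (hk i k c *: 1) * umx k j.
    by rewrite -scalerAl mul1r.
  rewrite -haar_invr copM cop_antip_umx (lin_sum _ _ ((tmul_bilin _ _).2 _)).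
  rewrite -/(contrr (haar G) _) (lin_sum _ _ (contrr_linear hP)) mulr_suml.
  by apply: eq_bigr=> m _; rewrite contrr_tmul// mulrA.
rewrite (eq_bigr _ (fun k _ => E k)) exchange_big/=.
rewrite -[LHS](sum_delta_scale j (fun m => contrr (hk i m) (cop G c))).
apply: eq_bigr=> m _; rewrite -mulr_sumr antip_umxl eq_sym.
by rewrite scaler_nat mulr_natr.
Qed.

End Coordinates.

(** * Covariance of the partial derivatives *)

Section Bundle.
Variables (R : realType) (G : cmqg R) (P : qbundle G).

Let FP : linear (Fco P) := linearP (Fco P).
Let copP : linear (cop G) := linearP (cop G).
Let haarP : scalar (haar G) := linearP (haar G).

Lemma Fco_contrr (psi : G -> R[i]) b : scalar psi ->
  Fco P (contrr psi (Fco P b)) = tmap id (fun c => contrr psi (cop G c)) (Fco P b).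
Proof.
move=> psiP; have [coassoc _] := Fco_coaction P.
rewrite -contrr_tmap// -tmap_contrr_tassoc// coassoc tmap_comp//.
exact: contrr_linear.
Qed.

(** Invariance of the average under the coaction: coassociativity of [F] moves [h] onto the first
    leg of the coproduct, where the left invariance of the Haar state applies. *)
Lemma Fco_vint b :
  tmap (fun b0 => contrr (haar G) (Fco P b0)) id (Fco P b) =
  contrr (haar G) (Fco P b) ⊗ 1.
Proof.
have [coassoc _] := Fco_coaction P.
have lP := @contrl_linear _ G G _ haarP.
have rP := @contrr_linear _ (ptotal P) G _ haarP.
rewrite -(tmap_comp _ FP (@linear_id _ _) rP (@linear_id _ _)) -tmap_contrl_tassoc// coassoc.
rewrite tmap_comp// -tmap_contrr_const//.
by congr (tmap _ _ _); apply: boolp.funext=> c; exact: haar_invl.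
Qed.

Variables (X : coord_space G) (Q : qmetric X) (E : ext_alg Q) (N : frame P E)
  (mu : qmeasure N).

Lemma omegaP_scalar : scalar (omegaP mu).
Proof. by move=> a u v; rewrite /omegaP /omegaM !linearP. Qed.

(** Averaging over the group is idempotent, because [F] is trivial on the base and [h(1) = 1]. *)
Lemma omegaP_vint b : omegaP mu (inc P (vint mu b)) = omegaP mu b.
Proof.
rewrite /omegaP; congr (omegaM _ _); apply: (@inc_inj _ _ P).
set f := vint mu b; rewrite vintE; have /base_fixed -> : exists g, inc P f = inc P g by exists f.
by rewrite -/(contrr (haar G) _) contrrE// haar1 scale1r.
Qed.

Lemma omegaP_inv b : contrl (omegaP mu) (Fco P b) = omegaP mu b *: 1.
Proof.
have := congr1 (contrl (omegaP mu)) (Fco_vint b).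
have rP := @contrr_linear _ (ptotal P) G _ haarP.
rewrite contrlE; last exact: omegaP_scalar.
rewrite (contrl_tmap _ (linear_comp FP rP) omegaP_scalar).
have E0 b0 : omegaP mu (contrr (haar G) (Fco P b0)) = omegaP mu b0.
  by rewrite -[in RHS]omegaP_vint vintE.
by rewrite E0 => <-; apply: eq_tlift=> b0 c; rewrite E0.
Qed.

End Bundle.

Section Frame.
Variables (R : realType) (G : cmqg R) (P : qbundle G) (X : coord_space G)
  (Q : qmetric X) (E : ext_alg Q) (N : frame P E) (mu : qmeasure N).

Local Notation th := (tnth (theta X)).
Local Notation d := (vdim X).
Local Notation F := (Fco P).
Local Notation ux := (@umx _ _ X).

Let FP : linear F := linearP F.
Let nablaP : linear (nabla N) := linearP (nabla N).
Let lcoP : linear (lco E) := linearP (lco E).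

Lemma nabla_base_linear : linear (fun b : ptotal P => nabla N (b ⊗ 1)).
Proof. exact: linear_comp ((tpure_bilin _ _).1 1) nablaP. Qed.

Definition hor_mul4 (q : ptotal P) (psi : Lam E) (b : ptotal P) (xi : Lam E) :
    hor P E :=
  \tsum_(b0 ⊗ c <- F b) (q * b0) ⊗ (lact psi c * xi).

Lemma hor_mul_cobilin (q : ptotal P) (psi xi : Lam E) :
  bilin (fun b0 c => (q * b0) ⊗ (lact psi c * xi)).
Proof.
have [lD rD lZ _ _] := lact_module E.
split=> [c|b0] a u v.
  by rewrite mulrDr -scalerAr tpureDl tpureZl.
by rewrite rD (lZ _ _ _).2 mulrDl -scalerAl tpureDr tpureZr.
Qed.

Lemma hor_mul4_bilinr q psi : bilin (hor_mul4 q psi).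
Proof.
split=> [xi|b]; first exact: linear_comp FP (tlift_linear (hor_mul_cobilin q psi xi)).
by apply: tlift_linearf=> b0 c a u v; rewrite mulrDr -scalerAr tpureDr tpureZr.
Qed.

Lemma hor_mul4_bilinl b xi : bilin (fun q psi => hor_mul4 q psi b xi).
Proof.
have [lD rD lZ _ _] := lact_module E.
split=> [psi|q]; apply: tlift_linearf=> b0 c a u v.
  by rewrite mulrDl -scalerAl tpureDl tpureZl.
by rewrite lD (lZ _ _ _).1 mulrDl -scalerAl tpureDr tpureZr.
Qed.

Lemma hor_mul_bilin : bilin (@hor_mul _ _ P _ _ E).
Proof. exact: tlift2_bilin hor_mul4_bilinr hor_mul4_bilinl. Qed.

Lemma hor_mulE q psi b xi :
  hor_mul (q ⊗ psi : hor P E) (b ⊗ xi) = hor_mul4 q psi b xi.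
Proof. exact: tlift2E hor_mul4_bilinr hor_mul4_bilinl. Qed.

Lemma hor_mul1E q b xi : hor_mul (q ⊗ 1 : hor P E) (b ⊗ xi) = (q * b) ⊗ xi.
Proof.
have [_ /(_ b) counit] := Fco_coaction P.
have lP : linear (fun b0 : ptotal P => (q * b0) ⊗ xi : hor P E).
  by move=> a u v; rewrite mulrDr -scalerAr tpureDl tpureZl.
rewrite hor_mulE -{2}counit.
rewrite (tlift_map _ _ (lin_zero lP) (lin_add lP)).
by apply: eq_tlift=> b0 c; rewrite lact1 -scalerAl mul1r tpureZr (lin_scale lP).
Qed.

Variable r : Lam E -> X.
Hypotheses (rP : linear r) (rK : cancel (lgen E) r).

Definition hcrd (i : 'I_d) (w : hor P E) : ptotal P :=
  contrr (fun psi => crd i (r psi)) w.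

Lemma crdr_scalar i : scalar (fun psi => crd i (r psi)).
Proof. by move=> a u v; rewrite rP crd_scalar. Qed.

Lemma hcrd_linear i : linear (hcrd i).
Proof. exact: contrr_linear (crdr_scalar i). Qed.

Lemma hcrdE i b psi : hcrd i (b ⊗ psi) = crd i (r psi) *: b.
Proof. by rewrite /hcrd contrrE//; exact: crdr_scalar. Qed.

(** As [r] inverts [lgen], the coefficients in [partialE] are determined by [nabla]; the linearity
    of [partial N i] follows from this. *)
Lemma partial_hcrd i b : partial N i b = hcrd i (nabla N (b ⊗ 1)).
Proof.
rewrite partialE (lin_sum _ _ (hcrd_linear i)).
rewrite -[LHS](sum_delta_scale i (fun k => partial N k b)).
by apply: eq_bigr=> k _; rewrite hcrdE rK crd_th.
Qed.

Lemma partial_linear i : linear (partial N i).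
Proof.
move=> a u v; rewrite !partial_hcrd.
exact: (linear_comp nabla_base_linear (hcrd_linear i)).
Qed.

Lemma hor_co_hcrd i (s : tens (ptotal P) G) y e :
  tmap (hcrd i) id (tmul13 s (y ⊗ e)) = crd i (r y) *: tmul s (1 ⊗ e).
Proof.
have hP := tmap_linear (hcrd_linear i) (@linear_id _ G).
have l1 := linear_comp ((@tmul13_bilin _ G (ptotal P) (Lam E)).1 (y ⊗ e)) hP.
have l2 : linear (fun s => crd i (r y) *: tmul s ((1 : ptotal P) ⊗ (e : G))).
  by move=> a u v; rewrite (tmul_bilin _ _).1 scalerDr !scalerA mulrC.
apply: (tens_linear_ext l1 l2) => x c.
rewrite tmul13E tmapE//; last exact: hcrd_linear.
by rewrite hcrdE tmulE mulr1 tpureZl.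
Qed.

(** The [i]-th coordinate of [nabla_co] at [b ⊗ 1]: the derivatives transform by the matrix [u] of
    the coaction on the basis forms. *)
Lemma partial_Fco i b :
  \sum_j tmul (F (partial N j b)) (1 ⊗ ux i j) = tmap (partial N i) id (F b).
Proof.
have hP := tmap_linear (hcrd_linear i) (@linear_id _ G).
have := congr1 (tmap (hcrd i) id) (nabla_co N (b ⊗ 1)).
rewrite partialE {1}/hor_co (lin_sum _ _ (coact2_linear FP lcoP)).
rewrite (lin_sum _ _ hP) => E1.
transitivity (\sum_j tmap (hcrd i) id
   (coact2 F (lco E) (partial N j b ⊗ lgen E (th j)))).
  apply: eq_bigr=> j _; rewrite coact2E// lco_lgen vco_th.
  have lP := tmap_linear (linearP (lgen E)) (@linear_id _ G).
  rewrite (lin_sum _ _ lP) (lin_sum _ _ ((tmul13_bilin _ _ _).2 _)).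
  rewrite (lin_sum _ _ hP) -[LHS](sum_delta_scale i (fun k => tmul _ (1 ⊗ ux k j))).
  apply: eq_bigr=> k _; rewrite tmapE//; last exact: linearP.
  by rewrite hor_co_hcrd rK crd_th.
rewrite E1 /hor_co coact2E// lco1.
rewrite tmap_comp//; last exact: hcrd_linear.
have nhP := linear_comp nablaP (hcrd_linear i).
have l1 := linear_comp ((@tmul13_bilin _ G (ptotal P) (Lam E)).1 (1 ⊗ 1)) (tmap_linear nhP (@linear_id _ G)).
have l2 := tmap_linear (partial_linear i) (@linear_id _ G).
apply: (tens_linear_ext l1 l2) => x c.
rewrite tmul13E (tmapE nhP (@linear_id _ _)) (tmapE (partial_linear i) (@linear_id _ _)) mulr1.
by rewrite -partial_hcrd.
Qed.

(** A dual basis relation: it compares coefficients in the expansion of [1 ⊗ th i] in the frame. *)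
Lemma frame_partial i j :
  \sum_(a : fidx N) bfr a (th i) * partial N j (inc P (ffr a)) = (i == j)%:R.
Proof.
have hP := hcrd_linear j.
have := congr1 (hcrd j) (frame_coord N (th i)).
rewrite hcrdE rK crd_th scaler_nat eq_sym => ->; rewrite (lin_sum _ _ hP).
apply: eq_bigr=> a _.
rewrite partialE (lin_sum _ _ (hor_mul_bilin.2 _)) (lin_sum _ _ hP).
rewrite -[LHS](sum_delta_scale j (fun k => _ * partial N k _)).
by apply: eq_bigr=> k _; rewrite hor_mul1E hcrdE rK crd_th.
Qed.

(* The average over the group of the maps [th j |-> (th k, th j) b]. *)
Definition avg (k : 'I_d) (b : ptotal P) (j : 'I_d) : ptotal P :=
  contrr (fun c => haar G (c * antip G (ux k j))) (F b).

(** The intertwining property of [avg k b]; coassociativity of [F] reduces it to [haar_umx]. *)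
Lemma Fco_avg k b j : F (avg k b j) = \sum_i avg k b i ⊗ ux i j.
Proof.
pose psi i c := haar G (c * antip G (ux k i)).
have psiP i : scalar (psi i) by exact: haar_mul_scalar.
rewrite (Fco_contrr _ (psiP j)).
have gP : linear (fun c => contrr (psi j) (cop G c)).
  exact: linear_comp (linearP (cop G)) (contrr_linear (psiP j)).
have sP : linear (fun t : tens (ptotal P) G => \sum_i contrr (psi i) t ⊗ ux i j).
  move=> a u v; rewrite scaler_sumr -big_split; apply: eq_bigr=> i _.
  by rewrite (contrr_linear (psiP i)) tpureDl tpureZl.
apply: (tens_linear_ext (tmap_linear (@linear_id _ _) gP) sP) => x c.
rewrite (tmapE (@linear_id _ _) gP) haar_umx tpure_sumr; apply: eq_bigr=> i _.
by rewrite contrrE// tpureZl tpureZr.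
Qed.

(* By [frame_partial], an intertwiner [beta] is the combination of the frame  *)
(* maps with coefficients [\sum_i partial_i(f_a) beta(th i)], which are       *)
(* invariant and hence in the base.                                           *)
Lemma avg_frame k b : exists f : fidx N -> pbase P,
  forall j, avg k b j = \sum_(a : fidx N) bfr a (th j) * inc P (f a).
Proof.
pose p (a : fidx N) := \sum_i partial N i (inc P (ffr a)) * avg k b i.
have [_ FM _] := Fco_hom P.
have p_fixed a : F (p a) = p a ⊗ 1.
  have Ff : F (inc P (ffr a)) = inc P (ffr a) ⊗ 1 by apply/base_fixed; exists (ffr a).
  rewrite /p (lin_sum _ _ FP) tpure_suml.
  under eq_bigr=> i _.
    rewrite FM Fco_avg (lin_sum _ _ ((tmul_bilin _ _).2 _)).
    under eq_bigr=> m _ do rewrite tmul_split.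
    over.
  rewrite exchange_big; apply: eq_bigr=> m _ /=.
  (* The sum over [i] is the left side of [partial_Fco], and [F] is trivial on the base element
     [ffr a]. *)
  rewrite -(lin_sum _ _ ((tmul_bilin _ _).1 _)) partial_Fco Ff.
  by rewrite (tmapE (partial_linear m) (@linear_id _ _)) tmulE mulr1.
(* The boolean equality lets [xchoose] select the base element as a function of [a]. *)
have p_base a : exists f, inc P f == p a.
  by have /base_fixed[f ->] := p_fixed a; exists f.
exists (fun a => xchoose (p_base a)) => j.
under eq_bigr=> a _ do rewrite (eqP (xchooseP (p_base a))) mulr_sumr.
rewrite exchange_big/= -[LHS](sum_delta_scale j (avg k b)).
apply: eq_bigr=> i _.
under [RHS]eq_bigr=> a _ do rewrite mulrA.
by rewrite -mulr_suml frame_partial mulr_natl scaler_nat.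
Qed.

(** Apply [omega_P] to the first factor of [partial_Fco], where its invariance makes the left side
    scalar multiples of the [u_is], and then the averaging functional to the second factor. The two
    slices of [F b] can be taken in either order. *)
Lemma omegaP_partial_avg k b i j :
  omegaP mu (partial N i (avg k b j)) =
  \sum_s omegaP mu (partial N s b) * haar G (ux i s * antip G (ux k j)).
Proof.
have oP := omegaP_scalar mu.
pose psi c := haar G (c * antip G (ux k j)).
have psiP : scalar psi by exact: haar_mul_scalar.
have := congr1 (contrl (omegaP mu)) (partial_Fco i b).
rewrite (lin_sum _ _ (contrl_linear oP)) (contrl_tmap _ (partial_linear i) oP).
under eq_bigr=> s _ do rewrite contrl_tmul1// omegaP_inv -scalerAl mul1r.
move=> /(congr1 psi).
rewrite (scalar_sum _ _ psiP) => E1.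
transitivity (psi (contrl (fun x => omegaP mu (partial N i x)) (F b))); last first.
  by rewrite -E1; apply: eq_bigr=> s _; rewrite (scalar_scale psiP).
have l1 : linear (fun t => omegaP mu (partial N i (contrr psi t)) : R[i]^o).
  by move=> a u v; rewrite (contrr_linear psiP) (partial_linear i) oP.
have opP : scalar (fun x => omegaP mu (partial N i x)).
  by move=> a u v; rewrite (partial_linear i) oP.
have l2 : linear (fun t => psi (contrl (fun x => omegaP mu (partial N i x)) t) : R[i]^o).
  by move=> a u v; rewrite (contrl_linear opP) psiP.
apply: (tens_linear_ext l1 l2) => x c.
rewrite contrrE// contrlE// (lin_scale (partial_linear i)).
rewrite (scalar_scale oP) (scalar_scale psiP).
exact: mulrC.
Qed.

End Frame.

(** * Vanishing of the integrals of partial derivatives *)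

Section Modular.
Variables (R : realType) (G : cmqg R) (X : coord_space G).

Local Notation th := (tnth (theta X)).
Local Notation d := (vdim X).
Local Notation ux := (@umx _ _ X).

(** If [C x = 0], then the squared norm of [vstar x] is [(x, C x) = 0], and [vstar] is injective. *)
Lemma Ck_inj : lker (Ck X) == 0%VS.
Proof.
apply/lker0P=> x y Cxy; apply/eqP; rewrite -subr_eq0; apply/eqP.
have C0 : Ck X (x - y) = 0 by rewrite linearB /= Cxy subrr.
apply: (inv_inj (@vstarK _ _ X)).
have dot0 u : vdot X u 0 = 0 by rewrite -(scale0r 0) dotZr mul0r.
have -> : vstar (x - y) = 0 by apply: (dot_eq0 (s := vdot X)); rewrite Ck_def C0 dot0.
by apply/esym/(dot_eq0 (s := vdot X)); rewrite Ck_def linear0 dot0.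
Qed.

Definition Cki (i j : 'I_d) : R[i] := crd i ((Ck X)^-1%VF (th j)).

(** In matrix form, [C^-1 u = kappa^2(u) C^-1]: apply [C^-1] to the covariance of [C] at
    [C^-1 (th s)]. *)
Lemma Cki_umx j s :
  \sum_i Cki j i *: ux i s = \sum_i Cki i s *: antip G (antip G (ux j i)).
Proof.
have vcoP : linear (vco X) := linearP (vco X).
have kP : linear (fun c => antip G (antip G c)).
  by move=> a u v; rewrite !linearP.
have CP : linear (Ck X) := linearP (Ck X).
have CiP : linear ((Ck X)^-1)%VF := linearP _.
have := Ck_vco ((Ck X)^-1%VF (th s)); rewrite lker0_lfunVK ?Ck_inj//.
move=> /(congr1 (tmap ((Ck X)^-1)%VF id)).
rewrite (tmap_comp _ CP kP CiP (@linear_id _ _)).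
have -> : (fun x => (Ck X)^-1%VF (Ck X x)) = id.
  by apply: boolp.funext=> x; rewrite lker0_lfunK ?Ck_inj.
have tCP := tmap_linear CiP (@linear_id _ G); have tkP := tmap_linear (@linear_id _ X) kP.
have cP := contrl_linear (V := G) (crd_scalar j).
rewrite vco_th (crdE ((Ck X)^-1%VF (th s))) (lin_sum _ _ vcoP).
rewrite (lin_sum _ _ tCP) (lin_sum _ _ tkP) => /(congr1 (contrl (crd j))).
rewrite !(lin_sum _ _ cP) => E1.
transitivity (\sum_i contrl (crd j) (tmap (Ck X)^-1%VF id (th i ⊗ ux i s))).
  apply: eq_bigr=> i _; rewrite (tmapE CiP (@linear_id _ _)) contrlE//.
  exact: crd_scalar.
rewrite {}E1; apply: eq_bigr=> i _.
rewrite (lin_scale vcoP) (lin_scale tkP) (lin_scale cP); congr (_ *: _).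
rewrite vco_th (lin_sum _ _ tkP).
under eq_bigr=> m _ do rewrite (tmapE (@linear_id _ _) kP).
by rewrite contrl_crd_sum.
Qed.

Lemma antip1 : antip G 1 = 1.
Proof.
have mP : bilin (fun a b : G => antip G a * b).
  exact: bilin_comp (@mulr_bilin _ G) (linearP (antip G)) (@linear_id _ _).
have [cop1 _ _] := cop_hom G.
have := antipl (1 : G); rewrite cop1 (tliftE _ _ (bilin_balanced mP)).
by rewrite mulr1 eps1 scale1r.
Qed.

(** After [Cki_umx] the product [kappa^2(u_ji) kappa(u_kj)] equals [kappa(u_kj kappa(u_ji))], whose
    sum over [j] is a Kronecker delta; finally [h(1) = 1]. *)
Lemma haar_Cki k s :
  \sum_i \sum_j Cki j i * haar G (ux i s * antip G (ux k j)) = Cki k s.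
Proof.
have hP : scalar (haar G) := linearP (haar G).
have hS := fun I r E => @scalar_sum _ _ _ I r E hP.
have kP : linear (antip G) := linearP (antip G).
rewrite exchange_big/=.
transitivity (\sum_j haar G ((\sum_i Cki j i *: ux i s) * antip G (ux k j))).
  apply: eq_bigr=> j _; rewrite mulr_suml hS; apply: eq_bigr=> i _.
  by rewrite -scalerAl (scalar_scale hP).
under eq_bigr=> j _ do rewrite Cki_umx mulr_suml hS.
rewrite exchange_big/= -[RHS](sum_delta_scale (W := R[i]^o) k (fun i => Cki i s)).
apply: eq_bigr=> i _.
transitivity (Cki i s * haar G (antip G (\sum_j ux k j * antip G (ux j i)))).
  rewrite (lin_sum _ _ kP) hS mulr_sumr; apply: eq_bigr=> j _.
  by rewrite -scalerAl (scalar_scale hP) antipM.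
rewrite antip_umxr -scaler_nat (lin_scale kP) antip1.
rewrite (scalar_scale hP) haar1 mulr1.
exact: mulrC.
Qed.

End Modular.

Section Integral.
Variables (R : realType) (G : cmqg R) (P : qbundle G) (X : coord_space G)
  (Q : qmetric X) (E : ext_alg Q) (N : frame P E) (mu : qmeasure N).
Variable r : Lam E -> X.
Hypotheses (rP : linear r) (rK : cancel (lgen E) r).
Local Notation th := (tnth (theta X)).

(** The integrals are assembled into a vector [v], and [C^-1 v = 0] is checked by coordinates: the
    [k]-th coordinate is the homogeneity expression for the intertwiner [avg k b]. *)
Lemma omegaP_partial i b : omegaP mu (partial N i b) = 0.
Proof.
have oP := omegaP_scalar mu.
pose v := \sum_s omegaP mu (partial N s b) *: th s.
suff v0 : v = 0.
  have := congr1 (crd i) v0.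
  rewrite (scalar_sum _ _ (crd_scalar i)).
  rewrite (scalar_zero (crd_scalar i)) => <-.
  rewrite -[LHS](sum_delta_scale (W := R[i]^o) i (fun s => omegaP mu (partial N s b))).
  apply: eq_bigr=> s _; rewrite (scalar_scale (crd_scalar i)) crd_th.
  exact: mulrC.
rewrite -[v](lker0_lfunVK (Ck_inj X)).
suff -> : ((Ck X)^-1)%VF v = 0 by rewrite linear0.
rewrite [LHS]crdE big1// => k _.
suff -> : crd k (((Ck X)^-1)%VF v) = 0 by rewrite scale0r.
rewrite /v linear_sum (scalar_sum _ _ (crd_scalar k)).
transitivity (\sum_s omegaP mu (partial N s b) * Cki k s).
  apply: eq_bigr=> s _; rewrite linearZ/=.
  by rewrite (scalar_scale (crd_scalar k)).
have [f fE] := avg_frame N rP rK k b.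
transitivity (omegaP mu (\sum_i \sum_j vdot X (th j) ((Ck X)^-1%VF (th i)) *:
   partial N i (avg k b j))); last first.
  (* [avg_frame] splits the expression into terms to which homogeneity applies separately. *)
  transitivity (\sum_(a : fidx N) omegaP mu (\sum_i \sum_j
      vdot X (th j) ((Ck X)^-1%VF (th i)) *:
      partial N i (bfr a (th j) * inc P (f a)))); last first.
    by apply: big1=> a _; exact: homogeneous.
  rewrite -(scalar_sum _ _ oP); congr omegaP.
  rewrite [RHS]exchange_big; apply: eq_bigr=> i' _.
  rewrite [RHS]exchange_big; apply: eq_bigr=> j _.
  by rewrite fE (lin_sum _ _ (partial_linear N rP rK i')) scaler_sumr.
rewrite (scalar_sum _ _ oP).
under [RHS]eq_bigr=> i' _.
  rewrite (scalar_sum _ _ oP).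
  under eq_bigr=> j _.
    rewrite (scalar_scale oP) (omegaP_partial_avg mu rP rK) dot_crd.
    rewrite -/(Cki j i') mulr_sumr.
    over.
  rewrite exchange_big.
  over.
rewrite exchange_big; apply: eq_bigr=> s _ /=.
rewrite -haar_Cki mulr_sumr; apply: eq_bigr=> i' _.
by rewrite mulr_sumr; apply: eq_bigr=> j _; rewrite mulrCA.
Qed.

End Integral.

(** * Integration by parts *)

Section Parts.
Variables (R : realType) (G : cmqg R) (P : qbundle G) (X : coord_space G)
  (Q : qmetric X) (E : ext_alg Q) (N : frame P E) (mu : qmeasure N).

Local Notation th := (tnth (theta X)).
Local Notation F := (Fco P).
Let FP : linear F := linearP F.

Lemma lact_linear (psi : Lam E) : linear (lact psi).
Proof. by have [_ rD rZ _ _] := lact_module E; move=> a u v; rewrite rD (rZ _ _ _).2. Qed.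

(** [F] respects stars, so the starred components of [F b] form [F (star b)]. *)
Lemma hor_starE (w : hor P E) :
  hor_star w = \tsum_(b ⊗ psi <- w) tmap id (lact (lstar psi)) (F (star b)).
Proof.
have [_ _ Fstar] := Fco_hom P.
apply: eq_tlift=> b psi.
have tP := tmap_linear (@linear_id _ (ptotal P)) (@lact_linear (lstar psi)).
rewrite Fstar /tstar (tlift_map _ _ (lin_zero tP) (lin_add tP)).
by apply: eq_tlift=> b0 c; rewrite (tmapE (@linear_id _ _) (@lact_linear _)).
Qed.

Lemma hor_star_balanced :
  balanced (fun (b : ptotal P) (psi : Lam E) =>
              tmap id (lact (lstar psi)) (F (star b))).
Proof.
have [lD _ lZ _ _] := lact_module E.
have [sD sZ] := star_antilinear (ptotal P).
have [tD tZ] := lstar_antilinear E.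
have tP psi := tmap_linear (@linear_id _ (ptotal P)) (@lact_linear psi).
split=> [b b' psi|b psi psi'|a b psi].
- by rewrite sD linearD (lin_add (tP _)).
- rewrite tD -tlift_addf; apply: eq_tlift=> b0 c.
  by rewrite lD tpureDr.
rewrite sZ tZ linearZ (lin_scale (tP _)).
have sP : linear (fun v : hor P E => a^* *: v).
  by move=> c u v; rewrite scalerDr !scalerA mulrC.
rewrite /tmap (tlift_map _ _ (lin_zero sP) (lin_add sP)).
by apply: eq_tlift=> b0 c; rewrite (lZ _ _ _).1 tpureZr.
Qed.

Lemma hor_star_pure (b : ptotal P) (psi : Lam E) :
  hor_star (b ⊗ psi) = tmap id (lact (lstar psi)) (F (star b)).
Proof. by rewrite hor_starE (tliftE _ _ hor_star_balanced). Qed.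

Lemma hor_star_sum I (s : seq I) (f : I -> hor P E) :
  hor_star (\sum_(i <- s) f i) = \sum_(i <- s) hor_star (f i).
Proof.
rewrite hor_starE (tlift_sum _ _ hor_star_balanced).
by apply: eq_bigr=> i _; rewrite hor_starE.
Qed.

Lemma hor_star1 (b : ptotal P) : hor_star (b ⊗ 1 : hor P E) = star b ⊗ 1.
Proof.
have [_ counit] := Fco_coaction P.
have epsP : scalar (eps G) := linearP (eps G).
rewrite hor_star_pure lstar1 -[in RHS](counit (star b)).
rewrite -/(contrr (eps G) _) -(tmap_contrr_const (Lam E) _ epsP).
by congr (tmap _ _ _); apply: boolp.funext=> c; rewrite lact1.
Qed.

Lemma hor_mul_lact (chi : Lam E) (s : tens (ptotal P) G) (q : ptotal P) :
  hor_mul (tmap id (lact chi) s : hor P E) (q ⊗ 1) =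
  tmap id (lact chi) (tmul s (F q)).
Proof.
have [_ _ _ _ lM] := lact_module E.
have tP := tmap_linear (@linear_id _ (ptotal P)) (@lact_linear chi).
have l1 := linear_comp tP ((hor_mul_bilin P E).1 (q ⊗ 1)).
have l2 := linear_comp ((tmul_bilin (ptotal P) G).1 (F q)) tP.
apply: (tens_linear_ext l1 l2) => b c.
rewrite (tmapE (@linear_id _ _) (@lact_linear _)) hor_mulE.
rewrite /hor_mul4.
have l3 : linear (fun t : tens (ptotal P) G =>
    \tsum_(b0 ⊗ e <- t) (b * b0) ⊗ (lact (lact chi c) e * 1)).
  exact: tlift_linear (hor_mul_cobilin _ _ _).
have l4 := linear_comp ((tmul_bilin (ptotal P) G).2 (b ⊗ c)) tP.
apply: (tens_linear_ext l3 l4 _ (F q)) => b0 e.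
rewrite (tliftE _ _ (bilin_balanced (hor_mul_cobilin _ _ _))) tmulE.
by rewrite (tmapE (@linear_id _ _) (@lact_linear _)) mulr1 lM.
Qed.

(** The product is [id ⊗ lact (lstar psi)] applied to [F (star u * q)]. Invariance of [omega_P]
    replaces the group leg by a multiple of [1], which acts trivially. *)
Lemma omegaP_hor_star (u q : ptotal P) (psi : Lam E) :
  contrl (omegaP mu) (hor_mul (hor_star (u ⊗ psi : hor P E)) (q ⊗ 1)) =
  omegaP mu (star u * q) *: lstar psi.
Proof.
have [_ FM _] := Fco_hom P.
have [_ _ _ l1 _] := lact_module E.
have oP := omegaP_scalar mu.
rewrite hor_star_pure hor_mul_lact -FM (contrl_tmapr _ (@lact_linear _) oP).
by rewrite omegaP_inv (lin_scale (@lact_linear _)) l1.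
Qed.

Variable r : Lam E -> X.
Hypotheses (rP : linear r) (rK : cancel (lgen E) r).

Lemma omegaP_parts (b q : ptotal P) :
  \sum_j omegaP mu (star b * partial N j q) *: th j +
  \sum_j omegaP mu (star (partial N j b) * q) *: vstar (th j) = 0.
Proof.
have oP := omegaP_scalar mu.
have cP := contrl_linear (V := Lam E) oP.
have deg0 : hor_deg 0 (star b ⊗ 1 : hor P E).
  exists [:: (star b, 1)]; rewrite ?big_seq1// => p; rewrite inE => /eqP->.
  exists (word [::]); last by rewrite proj_word big_nil.
  by exists [:: (1, [::])]; rewrite ?big_seq1 ?scale1r.
have := congr1 (contrl (omegaP mu)) (nabla_leibniz N (q ⊗ 1) deg0).
rewrite expr0 scale1r (lin_add cP) hor_mul1E partialE (lin_sum _ _ cP).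
(* The contracted left side of the Leibniz rule vanishes by [omegaP_partial]. *)
rewrite big1; last first.
  by move=> j _; rewrite contrlE// (omegaP_partial mu rP rK) scale0r.
(* Hermiticity turns [nabla (star b ⊗ 1)] into the star of [nabla (b ⊗ 1)]. *)
rewrite -hor_star1 nabla_star !partialE hor_star_sum.
rewrite (lin_sum _ _ ((hor_mul_bilin P E).1 _)) (lin_sum _ _ ((hor_mul_bilin P E).2 _)).
rewrite !(lin_sum _ _ cP) => E1.
(* The identity obtained lies in the exterior algebra; injectivity of [lgen] brings it back to
   [V]. *)
rewrite addrC; apply: (can_inj rK); rewrite !linearD !linear_sum linear0 {}[RHS]E1.
congr (_ + _); apply: eq_bigr=> j _; rewrite linearZ/=.
  by rewrite omegaP_hor_star lstar_lgen.
by rewrite hor_star1 hor_mul1E contrlE.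
Qed.

End Parts.

(** * The Dirac operator *)

Section Dirac.
Variables (R : realType) (G : cmqg R) (P : qbundle G) (X : coord_space G)
  (Q : qmetric X) (E : ext_alg Q) (Cl : clifford E) (N : frame P E)
  (mu : qmeasure N) (S : spinor Cl).

Local Notation th := (tnth (theta X)).
Local Notation F := (Fco P).
Local Notation spinors := (spinors P S).
Let FP : linear F := linearP F.
Let nablaP : linear (nabla N) := linearP (nabla N).
Let spcoP : linear (spco S) := linearP (spco S).

Definition cmul (psi : Lam E) (x : spin S) : spin S := gam S (1 ⊗ psi) x.

Lemma gam_bilin : bilin (fun Z (x : spin S) => gam S Z x).
Proof.
split=> [x|Z] a u v /=; last by rewrite linearP.
by rewrite linearP add_lfunE scale_lfunE.
Qed.

Lemma cmul_bilin : bilin cmul.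
Proof. exact: bilin_comp gam_bilin ((tpure_bilin _ _).2 1) (@linear_id _ _). Qed.

(** Clifford action of the form part of [w] on a spinor, keeping the bundle component. *)
Definition hor_act (w : hor P E) (x : spin S) : spinors :=
  tmap id (cmul^~ x) w.

Lemma hor_act_bilin : bilin hor_act.
Proof.
split=> [x|w]; first exact: tmap_linear (@linear_id _ _) (cmul_bilin.1 x).
apply: tlift_linearf=> q psi a x y.
by rewrite (cmul_bilin.2 psi) tpureDr tpureZr.
Qed.

Lemma hor_actE q psi x : hor_act (q ⊗ psi) x = q ⊗ cmul psi x.
Proof. by rewrite /hor_act (tmapE (@linear_id _ _) (cmul_bilin.1 x)). Qed.

Lemma Dirac_hor psi :
  Dirac N S psi = \tsum_(b ⊗ x <- psi) - 'i *: hor_act (nabla N (b ⊗ 1)) x.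
Proof.
apply: eq_tlift=> b x; congr (_ *: _).
rewrite partialE (lin_sum _ _ (hor_act_bilin.1 x)).
by apply: eq_bigr=> j _; rewrite hor_actE.
Qed.

Lemma Dirac_bilin : bilin (fun (b : ptotal P) x => - 'i *: hor_act (nabla N (b ⊗ 1)) x).
Proof.
apply: bilin_post (bilin_comp hor_act_bilin (nabla_base_linear N) (@linear_id _ _)) _.
by move=> a u v; rewrite scalerDr !scalerA mulrC.
Qed.

Lemma Dirac_linear : linear (Dirac N S).
Proof.
move=> a u v; rewrite !Dirac_hor; exact: (tlift_linear Dirac_bilin).
Qed.

Lemma DiracE b x : Dirac N S (b ⊗ x) = - 'i *: hor_act (nabla N (b ⊗ 1)) x.
Proof. by rewrite Dirac_hor (tliftE _ _ (bilin_balanced Dirac_bilin)). Qed.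

(** The right side of [spco_gam], with the coactions of the Clifford element and of the spinor
    replaced by arbitrary tensors. *)
Definition gam_act (Z : tens (tens (Sig Q) (Lam E)) G) (t : tens (spin S) G) :
    tens (spin S) G :=
  \tsum_(Z0 ⊗ c <- Z) \tsum_(x0 ⊗ e <- t) gam S Z0 x0 ⊗ (c * e).

Definition hor_act_co (s : tens (hor P E) G) (t : tens (spin S) G) :
    tens spinors G :=
  \tsum_(w ⊗ c <- s) \tsum_(x0 ⊗ e <- t) hor_act w x0 ⊗ (c * e).

Section TensorAct.
Variables (U V W : lmodType R[i]) (f : U -> V -> W) (fP : bilin f).

Lemma tens_act_bilinr x c : bilin (fun y (e : G) => f x y ⊗ (c * e)).
Proof.
split=> [e|y] a u v; first by rewrite fP.2 tpureDl tpureZl.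
by rewrite mulrDr -scalerAr tpureDr tpureZr.
Qed.

Lemma tens_act_bilinl y e : bilin (fun x (c : G) => f x y ⊗ (c * e)).
Proof.
split=> [c|x] a u v; first by rewrite fP.1 tpureDl tpureZl.
by rewrite mulrDl -scalerAl tpureDr tpureZr.
Qed.

End TensorAct.

Lemma gam_act_bilin : bilin gam_act.
Proof. exact: tlift2_bilin (tens_act_bilinr gam_bilin) (tens_act_bilinl gam_bilin). Qed.

Lemma gam_actE Z0 c x0 e : gam_act (Z0 ⊗ c) (x0 ⊗ e) = gam S Z0 x0 ⊗ (c * e).
Proof. exact: tlift2E (tens_act_bilinr gam_bilin) (tens_act_bilinl gam_bilin). Qed.

Lemma hor_act_co_bilin : bilin hor_act_co.
Proof. exact: tlift2_bilin (tens_act_bilinr hor_act_bilin) (tens_act_bilinl hor_act_bilin). Qed.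

Lemma hor_act_coE w c x0 e : hor_act_co (w ⊗ c) (x0 ⊗ e) = hor_act w x0 ⊗ (c * e).
Proof. exact: tlift2E (tens_act_bilinr hor_act_bilin) (tens_act_bilinl hor_act_bilin). Qed.

Lemma tmul13_gam_act (s : tens (ptotal P) G) (l : tens (Lam E) G)
    (t : tens (spin S) G) :
  tmul13 s (gam_act (tmul13 (1 ⊗ 1) l) t) = hor_act_co (tmul13 s l) t.
Proof.
have m1 := @tmul13_bilin _ G (ptotal P) (spin S).
have m2 := @tmul13_bilin _ G (Sig Q) (Lam E).
have m3 := @tmul13_bilin _ G (ptotal P) (Lam E).
have l1 := m1.1 (gam_act (tmul13 (1 ⊗ 1) l) t).
have l1' := linear_comp (m3.1 l) (hor_act_co_bilin.1 t).
apply: (tens_linear_ext l1 l1') => q c.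
have l2 := linear_comp (linear_comp (m2.2 (1 ⊗ 1)) (gam_act_bilin.1 t)) (m1.2 (q ⊗ c)).
have l2' := linear_comp (m3.2 (q ⊗ c)) (hor_act_co_bilin.1 t).
apply: (tens_linear_ext l2 l2' _ l) => psi c'.
have l3 := linear_comp (gam_act_bilin.2 (tmul13 (1 ⊗ 1) (psi ⊗ c'))) (m1.2 (q ⊗ c)).
have l3' := hor_act_co_bilin.2 (tmul13 (q ⊗ c) (psi ⊗ c')).
apply: (tens_linear_ext l3 l3' _ t) => x0 e.
by rewrite !tmul13E gam_actE hor_act_coE tmul13E hor_actE mul1r mulrA.
Qed.

(** Equivariance of the Clifford action, from [spco_gam] for [1 ⊗ psi]; the coefficient [1] in
    [Sig Q] is coinvariant. *)
Lemma spinors_co_hor_act w x :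
  spinors_co P S (hor_act w x) = hor_act_co (hor_co w) (spco S x).
Proof.
have lcoP : linear (lco E) := linearP (lco E).
have scoP : linear (sco Q) := linearP (sco Q).
have l1 := linear_comp (hor_act_bilin.1 x) (coact2_linear FP spcoP).
have l2 := linear_comp (coact2_linear FP lcoP) (hor_act_co_bilin.1 (spco S x)).
apply: (tens_linear_ext l1 l2) => q psi.
rewrite hor_actE !coact2E// spco_gam coact2E// sco1.
exact: tmul13_gam_act.
Qed.

Lemma Dirac_co psi :
  spinors_co P S (Dirac N S psi) = tmap (Dirac N S) id (spinors_co P S psi).
Proof.
have coP : linear (spinors_co P S) := coact2_linear FP spcoP.
have DP := tmap_linear Dirac_linear (@linear_id _ G).
apply: (tens_linear_ext (linear_comp Dirac_linear coP) (linear_comp coP DP)) => b x.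
rewrite DiracE (lin_scale coP) spinors_co_hor_act nabla_co.
have -> : hor_co (b ⊗ 1 : hor P E) = tmul13 (F b) (1 ⊗ 1).
  by rewrite /hor_co coact2E ?lco1//; exact: linearP.
rewrite [in RHS]/spinors_co coact2E//.
have m1 := @tmul13_bilin _ G (ptotal P) (Lam E).
have m2 := @tmul13_bilin _ G (ptotal P) (spin S).
have nP := tmap_linear nablaP (@linear_id _ G).
have iP : linear (fun v : tens spinors G => - 'i *: v).
  by move=> a u v; rewrite scalerDr !scalerA mulrC.
set t := spco S x.
have l1 := linear_comp (linear_comp (linear_comp (m1.1 (1 ⊗ 1)) nP) (hor_act_co_bilin.1 t)) iP.
have l1' := linear_comp (m2.1 t) DP.
apply: (tens_linear_ext l1 l1' _ (F b)) => q c.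
have l2 := linear_comp (hor_act_co_bilin.2 (tmap (nabla N) id (tmul13 (q ⊗ c) (1 ⊗ 1)))) iP.
have l2' := linear_comp (m2.2 (q ⊗ c)) DP.
apply: (tens_linear_ext l2 l2' _ t) => x0 e.
rewrite !tmul13E (tmapE nablaP (@linear_id _ _)) (tmapE Dirac_linear (@linear_id _ _)).
by rewrite hor_act_coE DiracE mulr1 tpureZl.
Qed.

Lemma spinors_dot_bilinr b x :
  bilin (fun (q : ptotal P) (y : spin S) =>
           (omegaP mu (star b * q) * sdot S x y : R[i]^o)).
Proof.
have oP := omegaP_scalar mu.
split=> [y|q] a u v.
  by rewrite mulrDr -scalerAr oP mulrDl -mulrA.
by rewrite dotDr dotZr mulrDr mulrCA.
Qed.

Lemma spinors_dot_balanced (phi : spinors) :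
  balanced (fun (b : ptotal P) (x : spin S) =>
    \tsum_(q ⊗ y <- phi) (omegaP mu (star b * q) * sdot S x y)).
Proof.
have [sD sZ] := star_antilinear (ptotal P).
have oD := lin_add (omegaP_scalar mu : linear (omegaP mu : _ -> R[i]^o)).
have oZ := lin_scale (omegaP_scalar mu : linear (omegaP mu : _ -> R[i]^o)).
split=> [b b' x|b x x'|a b x].
- by rewrite -tlift_addf; apply: eq_tlift=> q y; rewrite sD mulrDl oD mulrDl.
- rewrite -tlift_addf; apply: eq_tlift=> q y.
  by rewrite dot_conj dotDr rmorphD/= -!dot_conj mulrDr.
apply: eq_tlift=> q y; rewrite sZ -scalerAl oZ.
by rewrite [in RHS]dot_conj dotZr rmorphM/= -dot_conj mulrCA mulrA.
Qed.

Lemma spinors_dot_linearr (psi : spinors) :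
  linear (spinors_dot mu S psi : _ -> R[i]^o).
Proof.
apply: (@tlift_linearf _ (ptotal P) (spin S) spinors R[i]^o
  (fun phi b x => \tsum_(q ⊗ y <- phi) (omegaP mu (star b * q) * sdot S x y))).
by move=> b x; exact: tlift_linear (spinors_dot_bilinr b x).
Qed.

Lemma spinors_dot_suml I (s : seq I) (f : I -> spinors) phi :
  spinors_dot mu S (\sum_(k <- s) f k) phi = \sum_(k <- s) spinors_dot mu S (f k) phi.
Proof. exact: tlift_sum (spinors_dot_balanced phi). Qed.

Lemma spinors_dotE b x q y :
  spinors_dot mu S (b ⊗ x) (q ⊗ y) = omegaP mu (star b * q) * sdot S x y.
Proof.
rewrite /spinors_dot (tliftE _ _ (spinors_dot_balanced _)).
exact: (tliftE _ _ (bilin_balanced (spinors_dot_bilinr b x))).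
Qed.

Lemma Dirac_partial b x :
  Dirac N S (b ⊗ x) = \sum_j (- 'i *: partial N j b) ⊗ cmul (lgen E (th j)) x.
Proof.
rewrite DiracE partialE (lin_sum _ _ (hor_act_bilin.1 x)) scaler_sumr.
by apply: eq_bigr=> j _; rewrite hor_actE tpureZl.
Qed.

(** [gamma] is a [*]-representation. The vectors [th j] are fixed by [J], not by [vstar], so the
    adjoint of [gamma(th j)] involves [vstar (th j)], exactly as the second sum of [omegaP_parts]
    does. *)
Lemma sdot_cmul v x y :
  sdot S (cmul (lgen E v) x) y = sdot S x (cmul (lgen E (vstar v)) y).
Proof. by rewrite /cmul gam_star clstar_lgen. Qed.

Lemma Dirac_sym_pure b x q y :
  spinors_dot mu S (b ⊗ x) (Dirac N S (q ⊗ y)) =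
  spinors_dot mu S (Dirac N S (b ⊗ x)) (q ⊗ y).
Proof.
have [r [rP rK]] := lgen_retract Cl.
have [sD sZ] := star_antilinear (ptotal P).
have oZ := lin_scale (omegaP_scalar mu : linear (omegaP mu : _ -> R[i]^o)).
pose p v := sdot S x (cmul (lgen E v) y).
have pP : linear (p : _ -> R[i]^o).
  by move=> a u v; rewrite /p linearP (cmul_bilin.1 y) dotDr dotZr.
rewrite !Dirac_partial spinors_dot_suml (lin_sum _ _ (spinors_dot_linearr _)).
(* The sign from integration by parts is compensated by the conjugate of [- 'i], which appears when
   the scalar leaves the antilinear first argument. *)
have := congr1 (fun v => - 'i * p v) (omegaP_parts mu rP rK b q).
rewrite (lin_add pP) !(lin_sum _ _ pP) (lin_zero pP) mulr0 mulrDr !mulr_sumr.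
move/eqP; rewrite addr_eq0 => /eqP E1.
transitivity (\sum_j - 'i * p (omegaP mu (star b * partial N j q) *: th j)).
  apply: eq_bigr=> j _; rewrite spinors_dotE -scalerAr oZ (lin_scale pP).
  by rewrite -[in LHS]mulrA.
rewrite {}E1 -sumrN; apply: eq_bigr=> j _.
rewrite spinors_dotE sZ -scalerAl oZ (lin_scale pP) sdot_cmul rmorphN/= conjCi.
by rewrite opprK mulNr opprK -mulrA.
Qed.

Lemma Dirac_sym psi phi :
  spinors_dot mu S psi (Dirac N S phi) = spinors_dot mu S (Dirac N S psi) phi.
Proof.
have [s ->] := tens_sum psi; have [t ->] := tens_sum phi.
rewrite !(lin_sum _ _ Dirac_linear) !spinors_dot_suml; apply: eq_bigr=> p _.
rewrite !(lin_sum _ _ (spinors_dot_linearr _)); apply: eq_bigr=> p' _.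
exact: Dirac_sym_pure.
Qed.

End Dirac.

Theorem proposition4p1 (R : realType) (G : cmqg R) (P : qbundle G)
    (X : coord_space G) (Q : qmetric X) (E : ext_alg Q) (Cl : clifford E)
    (N : frame P E) (mu : qmeasure N) (S : spinor Cl) :
  [/\ (forall psi : spinors P S,
         spinors_co P S (Dirac N S psi) = tmap (Dirac N S) id (spinors_co P S psi)),
      (forall psi : spinors P S,
         spinors_co P S psi = psi ⊗ 1 ->
         spinors_co P S (Dirac N S psi) = Dirac N S psi ⊗ 1) &
      (forall psi phi : spinors P S,
         spinors_dot mu S psi (Dirac N S phi) =
         spinors_dot mu S (Dirac N S psi) phi)].
Proof.
split=> [psi|psi inv|psi phi]; [exact: Dirac_co | | exact: Dirac_sym].
by rewrite Dirac_co inv (tmapE (@Dirac_linear _ _ _ _ _ _ _ N S) (@linear_id _ _)).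
Qed.
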